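(* Let $\mathcal G$ be the cone graph: its vertices are $N$, $F$, $P$, and it has four edges numbered $1,2,3,4$, where edge $1$ joins $N$ and $F$, edges $2$ and $3$ are two parallel edges joining $N$ and $P$, and edge $4$ joins $P$ and $F$. Let $W_i(n)$ be the weight of edge $i$ at time $n$ in the trace-reinforced ant process on $\mathcal G$, and $\mathbf W(n)=(W_i(n))_{1\le i\le 4}$. Then almost surely when $n\to+\infty$, \[\frac{\mathbf W(n)}{n}\to \left(1,\tfrac13,\tfrac13,0\right).\]
   Context: Trace-reinforced ant process. Let $\mathcal G=(V,E)$ be a finite undirected graph (parallel edges allowed, each copy carrying its own weight) with two distinct marked nodes $N$ (nest) and $F$ (food). Random weights $\mathbf W(n)=(W_e(n))_{e\in E}$, $n\ge 0$, are defined recursively. At time $0$, $W_e(0)=1$ for all $e\in E$. Given $\mathbf W(n)$ (and independently of the rest of the past), run a random walk on $\mathcal G$ started at $N$ and stopped when it first hits $F$; at each step, from a vertex $u\ne F$, it crosses an edge $e$ incident to $u$ with probability $W_e(n)/\sum_{e'\sim u}W_{e'}(n)$, where the sum is over the edges $e'$ incident to $u$ (the weights being kept fixed equal to $\mathbf W(n)$ during the whole walk). Let $\gamma(n+1)$ be the set of edges crossed at least once by this walk, and set $W_e(n+1)=W_e(n)+\mathbf 1_{e\in\gamma(n+1)}$ for all $e\in E$. *)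

(* Defs.v *)
From mathcomp Require Import all_boot all_order all_algebra.
From mathcomp Require Import all_classical all_reals all_analysis.
Import numFieldNormedType.Exports.

Set Implicit Arguments.
Unset Strict Implicit.
Unset Printing Implicit Defensive.

Import Order.TTheory GRing.Theory Num.Theory.
Local Open Scope classical_set_scope.
Local Open Scope ring_scope.

(* Edges are a type of their own, so that parallel edges are allowed; the order
   of the two components of [ends e] is irrelevant. *)
Record ant_graph := AntGraph {
  vertex : finType;
  edge : finType;
  ends : edge -> vertex * vertex;
  nest : vertex;
  food : vertex;
  nest_neq_food : nest != food }.

Section Walks.
Variable G : ant_graph.

Definition incident (u : vertex G) (e : edge G) : bool :=
  (u == (ends e).1) || (u == (ends e).2).

(* Meaningful only when [e] is incident to [u]; edges that are not incident to
   the current vertex are crossed with probability 0. *)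
Definition across (u : vertex G) (e : edge G) : vertex G :=
  if u == (ends e).1 then (ends e).2 else (ends e).1.

Definition endpoint (p : seq (edge G)) : vertex G := foldl across (nest G) p.

Definition cross_prob (R : realType) (w : edge G -> nat) (u : vertex G)
    (e : edge G) : R :=
  if incident u e then (w e)%:R / \sum_(e' | incident u e') (w e')%:R else 0.

(* [step n k] is the edge chosen at the [k]-th step (counting from 0) of the
   walk run between times [n] and [n.+1]; it has no effect once that walk has
   reached the food. *)
Variables (T : Type) (step : nat -> nat -> T -> edge G).

(* The edges crossed, in order, during the first [k] steps. *)
Fixpoint walk (n k : nat) (t : T) : seq (edge G) :=
  if k is k'.+1 then
    let p := walk n k' t in
    if endpoint p == food G then p else rcons p (step n k' t)
  else [::].

(* The index is shifted: [trace n] is gamma(n+1). *)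
Definition trace (n : nat) (t : T) : {set edge G} :=
  [set e | `[< exists k, e \in walk n k t >]]%SET.

Fixpoint weight (n : nat) (t : T) (e : edge G) : nat :=
  if n is n'.+1 then (weight n' t e + (e \in trace n' t))%N else 1%N.

(* The sigma-algebra generated by the walks run before time [n]. *)
Definition past (n : nat) : set (set T) :=
  <<s [set B | exists m k p, (m < n)%N /\ B = [set t | walk m k t = p]] >>.

End Walks.

(* [step_law]: conditionally on the walks run before time [n] and on the
   beginning [p] of the current one, the next edge is chosen according to the
   weights at time [n]. As weights and walks take countably many values, the
   conditioning on them is written with elementary events. *)
Record ant_process (G : ant_graph) (R : realType) (d : measure_display)
    (T : measurableType d) (P : probability T R)
    (step : nat -> nat -> T -> edge G) : Prop := AntProcess {
  measurable_step : forall n k e, measurable [set t | step n k t = e];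
  step_law : forall (n k : nat) (A : set T) (w : edge G -> nat)
      (p : seq (edge G)) (e : edge G),
    past step n A -> endpoint p != food G ->
    let B := A `&` [set t | forall e', weight step n t e' = w e']
               `&` [set t | walk step n k t = p] in
    (P (B `&` [set t | step n k t = e])
     = (cross_prob R w (endpoint p) e)%:E * P B)%E }.

Definition coneN : 'I_3 := @Ordinal 3 0 isT.
Definition coneF : 'I_3 := @Ordinal 3 1 isT.
Definition coneP : 'I_3 := @Ordinal 3 2 isT.

(* Edge number [i.+1] of the cone graph is [i : 'I_4]. *)
Definition cone_ends (i : 'I_4) : 'I_3 * 'I_3 :=
  match val i with
  | 0 => (coneN, coneF)
  | 1 | 2 => (coneN, coneP)
  | _ => (coneP, coneF)
  end.

Definition cone : ant_graph := @AntGraph 'I_3 'I_4 cone_ends coneN coneF isT.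

Definition weight_row (R : realType) (T : Type)
    (step : nat -> nat -> T -> edge cone) (n : nat) (t : T) : 'rV[R]_4 :=
  \row_(i < 4) (weight step n t i)%:R.

Definition cone_limit (R : realType) : 'rV[R]_4 :=
  \row_(i < 4) [:: 1; 3^-1; 3^-1; 0]`_i.

(* Main.v *)
(* A walk ends by crossing exactly one of the edges 1 and 4, so almost surely
   W_1(n) + W_4(n) = N with N = n + 2. Solving for the harmonic functions of the
   stopped walk gives the crossing probabilities in closed form, and for
   L(n) = 7 (H_N - H_{W_1}) + (H_N - H_{W_2}) + (H_N - H_{W_3})
          + 3 (W_2 + W_3) / N + 6 / N
   (H_k being the sum of 1/j over j < k), the expected increment of L(n) is at
   most - phi(n) / (324 N), where, in terms of the shares x = W_4 / N,
   b = W_2 / N and c = W_3 / N,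
   phi = x^2 + (b + c) ((1 - 3 b)^2 + (1 - 3 c)^2).
   Hence L(n) plus the sum of phi(m) / (324 (m + 2)) over m < n has bounded
   expectation, and by Fatou's lemma it is almost surely bounded along a
   subsequence. So the series of phi(n) / N converges; as phi has increments
   O(1 / N), phi tends to 0. Since H_N - H_{W_2} is about log (N / W_2), b stays
   away from 0 along a subsequence, which prevents (b, c) from approaching
   (0, 0), the only other zero of phi. *)
Require Import Defs.
From mathcomp Require Import all_boot all_order all_algebra.
From mathcomp Require Import all_classical all_reals all_analysis.
From mathcomp Require Import measurable_realfun ring lra.
Import numFieldNormedType.Exports.
Import Order.TTheory GRing.Theory Num.Theory.
Local Open Scope classical_set_scope.
Local Open Scope ring_scope.

Set Implicit Arguments.
Unset Strict Implicit.
Unset Printing Implicit Defensive.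

(** * Drift inequality *)

Section Drift.
Variable R : realFieldType.
Implicit Types b c x y m : R.

Definition imbalance b c : R := (1 - 3 * b) ^+ 2 + (1 - 3 * c) ^+ 2.

(** Up to the term [- x ^+ 2], the numerator of the relative loss of an edge of share [b] parallel
    to one of share [c]. Up to the term [x * (1 - x)], [resist] is its denominator. *)
Definition excess b c : R := b ^+ 2 + 2 * b * c - c.

Definition resist b c : R := b + c + b ^+ 2 + 2 * b * c.

(* The drift, over a common denominator, is affine in [x * (1 - x)]; this lemma
   and the next bound its two coefficients. *)
Lemma drift_slope b c : 0 <= b <= 1 -> 0 <= c <= 1 ->
  (b + c) * imbalance b c / 12 <=
  - (1 - 3 * b) * excess b c - (1 - 3 * c) * excess c b.
Proof.
move=> /andP[b0 b1] /andP[c0 c1]; rewrite -subr_ge0.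
(* In terms of [b + c] and [(b - c) ^+ 2], the difference is a sum of nonnegative terms. *)
have -> : - (1 - 3 * b) * excess b c - (1 - 3 * c) * excess c b -
   (b + c) * imbalance b c / 12 =
   (5 / 6) * ((b + c) * (1 - 3 / 2 * (b + c)) ^+ 2)
   + (b - c) ^+ 2 * (2 + 3 / 8 * (b + c)).
  by rewrite /excess /imbalance; field.
have h1 : 0 <= (b + c) * (1 - 3 / 2 * (b + c)) ^+ 2.
  by apply: mulr_ge0; [lra | exact: sqr_ge0].
have h2 : 0 <= (b - c) ^+ 2 * (2 + 3 / 8 * (b + c)).
  by apply: mulr_ge0; [exact: sqr_ge0 | lra].
lra.
Qed.

Lemma drift_constant b c : 0 <= b <= 1 -> 0 <= c <= 1 ->
  (b + c) ^+ 2 * imbalance b c / 12 <=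
  - (1 - 3 * b) * excess b c * resist c b
  - (1 - 3 * c) * excess c b * resist b c.
Proof.
move=> /andP[b0 b1] /andP[c0 c1]; rewrite -subr_ge0.
have -> : - (1 - 3 * b) * excess b c * resist c b
    - (1 - 3 * c) * excess c b * resist b c
    - (b + c) ^+ 2 * imbalance b c / 12 =
  (b + c) ^+ 2 * (1 - 3 / 2 * (b + c)) ^+ 2 * (5 / 6 + 3 / 4 * (b + c))
  + (b - c) ^+ 2 * ((b + c) * (9 / 4 + (21 / 8) * (b + c)
       - 15 / 8 * (b + c) ^+ 2)
     + 2 * b * c + 3 / 16 * (b + c) * (b - c) ^+ 2).
  by rewrite /excess /imbalance /resist; field.
have bc0 : 0 <= b * c by exact: mulr_ge0.
apply: addr_ge0.
  by apply: mulr_ge0; [rewrite -exprMn sqr_ge0 | lra].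
apply: mulr_ge0; first exact: sqr_ge0.
apply: addr_ge0.
  apply: addr_ge0; last lra.
  apply: mulr_ge0; first lra.
  (* With [s = b + c], this factor equals [15/8 * (2 - s) * (s + 3/5)]: it is nonnegative on [0, 2]
     and vanishes at [s = 2]. *)
  nra.
by apply: mulr_ge0; [lra | exact: sqr_ge0].
Qed.

(* When the total weight is [n], [1 - n p / w] is the relative loss of the share
   [w / n] of an edge of weight [w] which is crossed with probability [p]. *)
Lemma drift_le x b c m : 0 <= x <= 1 -> 0 < b <= 1 -> 0 < c <= 1 -> 0 <= m ->
  7 * (1 - (x + (b + c)) / (b + c + x * (1 - x)))
  + (1 - 3 * b + 3 * b * m) *
    (1 - (b + c + c + x) / (resist b c + x * (1 - x)))
  + (1 - 3 * c + 3 * c * m) *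
    (1 - (c + b + b + x) / (resist c b + x * (1 - x)))
  - 6 * m <= - (x ^+ 2 + (b + c) * imbalance b c) / 324.
Proof.
move=> /andP[x0 x1] /andP[b0 b1] /andP[c0 c1] m0.
have bc0 : 0 < b * c by exact: mulr_gt0.
have y0 : 0 <= x * (1 - x) by apply: mulr_ge0; lra.
have y1 : x * (1 - x) <= 1 by nra.
have hlin := @drift_slope b c.
have hcst := @drift_constant b c.
set y := x * (1 - x) in y0 y1 *.
set S := b + c + y.
have S0 : 0 < S by rewrite /S; lra.
have S3 : S <= 3 by rewrite /S; lra.
set DA := resist b c + y; set DB := resist c b + y.
have bb : b ^+ 2 <= b by rewrite expr2; nra.
have cc : c ^+ 2 <= c by rewrite expr2; nra.
have bcb : b * c <= b by nra.
have bcc : b * c <= c by nra.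
have SA : S <= DA by rewrite /DA /resist /S; have := sqr_ge0 b; lra.
have SB : S <= DB by rewrite /DB /resist /S; have := sqr_ge0 c; lra.
have DA3 : DA <= 3 * S by rewrite /DA /resist /S; lra.
have DB9 : DB <= 9 by rewrite /DB /resist; lra.
have DA0 : 0 < DA by exact: lt_le_trans SA.
have DB0 : 0 < DB by exact: lt_le_trans SB.
have eA : 1 - (b + c + c + x) / DA = (excess b c - x ^+ 2) / DA.
  apply: (mulIf (lt0r_neq0 DA0)); rewrite mulrBl !divfK ?lt0r_neq0//.
  by rewrite /DA /excess /resist /y; ring.
have eB : 1 - (c + b + b + x) / DB = (excess c b - x ^+ 2) / DB.
  apply: (mulIf (lt0r_neq0 DB0)); rewrite mulrBl !divfK ?lt0r_neq0//.
  by rewrite /DB /excess /resist /y; ring.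
have eS : 1 - (x + (b + c)) / S = - (x ^+ 2 / S).
  apply: (mulIf (lt0r_neq0 S0)); rewrite mulrBl mulNr !divfK ?lt0r_neq0//.
  by rewrite /S /y; ring.
rewrite eA eB eS.
have x2 : 0 <= x ^+ 2 by exact: sqr_ge0.
have xS : x ^+ 2 / 3 <= x ^+ 2 / S.
  by apply: ler_wpM2l => //; rewrite lef_pV2 ?posrE.
have xA : x ^+ 2 / DA <= x ^+ 2 / S.
  by apply: ler_wpM2l => //; rewrite lef_pV2 ?posrE.
have xB : x ^+ 2 / DB <= x ^+ 2 / S.
  by apply: ler_wpM2l => //; rewrite lef_pV2 ?posrE.
have xA0 : 0 <= x ^+ 2 / DA by apply: divr_ge0 => //; exact: ltW.
have xB0 : 0 <= x ^+ 2 / DB by apply: divr_ge0 => //; exact: ltW.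
(* Relative losses are at most 1 and [b, c <= 1], so the two terms carrying [m] contribute at most
   [6 * m], which the last term of the sum cancels. *)
have qA : (excess b c - x ^+ 2) / DA <= 1.
  by rewrite ler_pdivrMr// mul1r /DA /resist /excess; lra.
have qB : (excess c b - x ^+ 2) / DB <= 1.
  by rewrite ler_pdivrMr// mul1r /DB /resist /excess; lra.
have tA : 3 * b * m * ((excess b c - x ^+ 2) / DA) <= 3 * m.
  have bm : 0 <= b * m by apply: mulr_ge0; lra.
  have : b * m <= m by nra.
  nra.
have tB : 3 * c * m * ((excess c b - x ^+ 2) / DB) <= 3 * m.
  have cm : 0 <= c * m by apply: mulr_ge0; lra.
  have : c * m <= m by nra.
  nra.
(* Edges 2 and 3 thus cost at most [4 * x ^+ 2 / S]. The coefficient 7 of edge 1 leaves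
   [- 3 * x ^+ 2 / S], which is at most [- x ^+ 2] as [S <= 3]. *)
have rA : (3 * b - 1) * (x ^+ 2 / DA) <= 2 * (x ^+ 2 / S) by nra.
have rB : (3 * c - 1) * (x ^+ 2 / DB) <= 2 * (x ^+ 2 / S) by nra.
have K : (1 - 3 * b) * (excess b c / DA) + (1 - 3 * c) * (excess c b / DB)
   <= - ((b + c) * imbalance b c) / 324.
  have w0 : 0 <= (b + c) * imbalance b c.
    by apply: mulr_ge0; [lra | apply: addr_ge0; exact: sqr_ge0].
  (* Here [27 = 3 * 9], from [DA <= 3 * S] and [DB <= 9]; with the factor 12 of the two coefficient
     bounds it yields [324 = 12 * 27]. *)
  have DAB : DA * DB <= 27 * S.
    have h : DA * DB <= DA * 9 by rewrite ler_pM2l.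
    lra.
  have -> : (1 - 3 * b) * (excess b c / DA) + (1 - 3 * c) * (excess c b / DB)
     = ((1 - 3 * b) * excess b c * DB + (1 - 3 * c) * excess c b * DA)
       / (DA * DB).
    by field; rewrite !lt0r_neq0.
  rewrite ler_pdivrMr ?mulr_gt0//.
  (* The numerator is affine in [y]: [drift_constant] bounds its value at [y = 0], and [drift_slope]
     multiplied by [y] bounds the rest. *)
  apply: (@le_trans _ _ (- ((b + c) * imbalance b c) / 12 * S)); last first.
    have := ler_wpM2l w0 DAB; lra.
  have {}hlin := hlin ltac:(lra) ltac:(lra).
  have {}hcst := hcst ltac:(lra) ltac:(lra).
  have := ler_wpM2l y0 hlin.
  move: hcst; rewrite /S /DA /DB expr2; lra.
lra.
Qed.

End Drift.

(** * Crossing probabilities in closed form and the expected increment *)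

Section Crossing.
Variable R : realFieldType.
Implicit Types a b c e x y : R.

Lemma ratio_lt1 x y : 0 < y -> x < y -> x / y < 1.
Proof. by move=> y0 xy; rewrite ltr_pdivrMr// mul1r. Qed.

Lemma ratio_itv01 x y : 0 < y -> 0 <= x -> x <= y -> 0 <= x / y <= 1.
Proof.
by move=> y0 x0 xy; rewrite divr_ge0 ?(ltW y0)//= ler_pdivrMr// mul1r.
Qed.

(** The probability of leaving through the edge of weight [a], by Ohm's law: the conductance [a]
    competes with [b + c] and [e] in series. *)
Definition direct_prob a b c e : R :=
  a * (e + (b + c)) / ((a + e) * (b + c) + a * e).

(* The probability that a walk with weights [a, b, c, e] crosses the edge of
   weight [b]. *)
Definition detour_prob a b c e : R :=
  b * (b + c + c + e) / ((a + e) * (b + c) + a * e + b * (b + c + c)).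

(** This is [drift_le] for the shares relative to [m], divided by [m]. The left-hand side is the
    conditional expectation of the increment of [potential], plus the dissipation rate, when the two
    exit edges have total weight [m]. *)
Lemma expected_increment_le0 a b c e m p q :
  0 < a -> 0 < b -> 0 < c -> 0 < e -> b <= m -> c <= m -> m = a + e ->
  p = detour_prob a b c e -> q = detour_prob a c b e ->
  7 * (m^-1 - direct_prob a b c e / a) + (m^-1 - p / b) + (m^-1 - q / c)
  + 3 * ((b + p) / (m + 1) - b / m) + 3 * ((c + q) / (m + 1) - c / m)
  + (6 / (m + 1) - 6 / m)
  + ((e / m) ^+ 2 + (b / m + c / m) * imbalance (b / m) (c / m)) / (324 * m)
  <= 0.
Proof.
move=> a0 b0 c0 e0 bm cm mE pE qE.
have m0 : 0 < m by rewrite mE; lra.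
have m10 : 0 < m + 1 by lra.
have [ma me] : a = m - e /\ e <= m by rewrite mE; split; lra.
(* The parameter [(m + 1)^-1] comes from the shares changing denominator from [m] to [m + 1]; the
   decrease of [6 / m] pays for that error. *)
have := @drift_le R (e / m) (b / m) (c / m) (m + 1)^-1.
have le01 (z : R) : 0 < z -> z <= m -> 0 < z / m <= 1.
  by move=> z0 zm; rewrite divr_gt0//= ler_pdivrMr// mul1r.
have /andP[e0m e1m] := le01 e e0 me.
move=> /(_ _ (le01 b b0 bm) (le01 c c0 cm) _); rewrite (ltW e0m) e1m.
rewrite invr_ge0 (ltW m10) => /(_ isT isT).
set phi := (e / m) ^+ 2 + _.
have bc0 : 0 < b * c by exact: mulr_gt0.
have ab0 : 0 < a * b by exact: mulr_gt0.
have ac0 : 0 < a * c by exact: mulr_gt0.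
have ae0 : 0 < a * e by exact: mulr_gt0.
have be0 : 0 < e * b by exact: mulr_gt0.
have ce0 : 0 < e * c by exact: mulr_gt0.
have bb0 : 0 < b * b by exact: mulr_gt0.
have cc0 : 0 < c * c by exact: mulr_gt0.
have -> : (e / m + (b / m + c / m)) / (b / m + c / m + e / m * (1 - e / m)) =
   m * (direct_prob a b c e / a).
  rewrite /direct_prob ma; field.
  by rewrite -ma !lt0r_neq0//; lra.
have detour (v w : R) : 0 < v -> 0 < w -> 0 < v * w -> 0 < a * v -> 0 < a * w ->
  0 < e * v -> 0 < e * w -> 0 < v * v ->
  (v / m + w / m + w / m + e / m) /
    (resist (v / m) (w / m) + e / m * (1 - e / m)) = m * (detour_prob a v w e / v).
  move=> v0 w0 *; rewrite /detour_prob /resist ma; field.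
  by rewrite -ma !lt0r_neq0//; lra.
have cb0 : 0 < c * b by rewrite mulrC.
rewrite (detour b c b0 c0 bc0 ab0 ac0 be0 ce0 bb0).
rewrite (detour c b c0 b0 cb0 ac0 ab0 ce0 be0 cc0).
rewrite -pE -qE => h.
have key : 7 * (1 - m * (direct_prob a b c e / a)) +
    (1 - 3 * (b / m) + 3 * (b / m) * (m + 1)^-1) * (1 - m * (p / b)) +
    (1 - 3 * (c / m) + 3 * (c / m) * (m + 1)^-1) * (1 - m * (q / c)) -
    6 * (m + 1)^-1 + phi / 324 <= 0 by lra.
rewrite -(pmulr_rle0 _ m0); apply: le_trans key.
rewrite le_eqVlt; apply/orP; left; apply/eqP.
by field; rewrite !lt0r_neq0//; lra.
Qed.

End Crossing.

(** * Sequences with small increments *)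

Section Sequences.
Variable R : realType.
Implicit Types u : nat -> R.

Lemma inv_add2_sum_unbounded (C : R) :
  exists n, C < \sum_(0 <= m < n) (m%:R + 2)^-1.
Proof.
apply: contrapT => /forallNP h.
apply: (@dvg_harmonic R).
apply: nondecreasing_is_cvgn.
  by apply: nondecreasing_series => n _ _ /=; exact: harmonic_ge0.
exists (1 + C) => _ [n _ <-].
apply: (@le_trans _ _ (series harmonic n.+1)).
  by rewrite /series/= big_nat_recr//= lerDl harmonic_ge0.
rewrite /series/= big_nat_recl//= invr1 lerD2l leNgt; apply/negP => hn.
apply: (h n); apply: (lt_le_trans hn); apply: ler_sum => i _.
by rewrite /harmonic/= -natrD addn2.
Qed.

Lemma inv_add2_sqr_sum_le1 n : \sum_(0 <= m < n) ((m%:R + 2)^-1) ^+ 2 <= 1 :> R.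
Proof.
(* The strengthened bound telescopes: [1 / (n + 2) ^ 2 <= 1 / (n + 1) - 1 / (n + 2)]. *)
suff : \sum_(0 <= m < n) ((m%:R + 2)^-1) ^+ 2 <= 1 - (n%:R + 1)^-1 :> R.
  move=> h; apply: (le_trans h); rewrite gerBl invr_ge0.
  by have := ler0n R n; lra.
elim: n => [|n ih]; first by rewrite big_nil add0r invr1 subrr.
rewrite big_nat_recr //=; apply: (le_trans (lerD ih (lexx _))).
have n0 := ler0n R n.
rewrite -[n.+1%:R]natr1; set m : R := n%:R in n0 *.
have : 0 <= (m + 1)^-1 * (m + 2)^-1 ^+ 2.
  by rewrite mulr_ge0 ?sqr_ge0// invr_ge0; lra.
have -> : (m + 1)^-1 * (m + 2)^-1 ^+ 2 =
   (m + 1)^-1 - (m + 1 + 1)^-1 - (m + 2) ^-1 ^+ 2.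
  by field; rewrite !lt0r_neq0//; lra.
lra.
Qed.

(* The increments of [u ^ 2] are summable, being at most
   [K / (n + 2) * (2 u + K / (n + 2))]; so [u ^ 2] converges, and its limit is 0
   because the harmonic series diverges. *)
Lemma barbalat u (K C : R) : (forall n, 0 <= u n) ->
  (forall n, `|u n.+1 - u n| <= K * (n%:R + 2)^-1) ->
  (forall n, \sum_(0 <= m < n) u m * (m%:R + 2)^-1 <= C) ->
  u @ \oo --> 0.
Proof.
move=> u0 du uC.
pose h n : R := (n%:R + 2)^-1.
have h0 n : 0 < h n by rewrite invr_gt0; have := ler0n R n; lra.
have K0 : 0 <= K.
  have := le_trans (normr_ge0 _) (du 0%N).
  by rewrite pmulr_lge0//; exact: h0.
pose s m := 2 * K * (u m * h m) + K ^+ 2 * h m ^+ 2.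
pose S n := \sum_(0 <= m < n) s m.
have du2 n : `|u n.+1 ^+ 2 - u n ^+ 2| <= s n.
  have -> : u n.+1 ^+ 2 - u n ^+ 2 =
    (u n.+1 - u n) * (2 * u n + (u n.+1 - u n)) by ring.
  have -> : s n = (K * h n) * (2 * u n + K * h n) by rewrite /s; ring.
  rewrite normrM; apply: ler_pM => //.
  apply: (le_trans (ler_normD _ _)); apply: lerD; last exact: du.
  by rewrite ger0_norm// mulr_ge0.
have s0 n : 0 <= s n by apply: le_trans (du2 n).
have Sb n : S n <= 2 * K * C + K ^+ 2.
  rewrite /S /s big_split/= -!mulr_sumr; apply: lerD.
    by apply: ler_wpM2l; [rewrite mulr_ge0 | exact: uC].
  by rewrite -[leRHS]mulr1; apply: ler_wpM2l; [exact: sqr_ge0 |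
    exact: inv_add2_sqr_sum_le1].
have cS : cvgn S.
  apply: nondecreasing_is_cvgn.
    by apply: nondecreasing_series => n _ _; exact: s0.
  by exists (2 * K * C + K ^+ 2) => _ [n _ <-]; exact: Sb.
have uS n : u n ^+ 2 <= u 0%N ^+ 2 + S n.
  elim: n => [|n ih]; first by rewrite /S big_nil addr0.
  rewrite /S big_nat_recr//= -/(S n).
  by have := du2 n; rewrite ler_norml => /andP[_]; lra.
(* Since [s] dominates the increments of [u ^+ 2], adding its partial sums makes the sequence
   monotone; subtracting the convergent [S] then recovers [u ^+ 2]. *)
have cuS : cvgn (fun n => u n ^+ 2 + S n).
  apply: nondecreasing_is_cvgn.
    apply/nondecreasing_seqP => n; rewrite /S big_nat_recr//= -/(S n).
    by have := du2 n; rewrite ler_norml => /andP[]; lra.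
  exists (u 0%N ^+ 2 + (2 * K * C + K ^+ 2) * 2) => _ [n _ <-] /=.
  by have := uS n; have := Sb n; lra.
have cu2 : cvgn (fun n => u n ^+ 2).
  have -> : (fun n => u n ^+ 2) = (fun n => u n ^+ 2 + S n) - S.
    by apply/funext => n /=; rewrite !fctE addrK.
  exact: is_cvgB.
have [l cl] : exists l : R, u @ \oo --> l.
  move/cvg_ex : cu2 => [l cl]; exists (Num.sqrt l).
  have -> : u = Num.sqrt \o (fun n => u n ^+ 2).
    by apply/funext => n /=; rewrite sqrtr_sqr ger0_norm.
  by apply: continuous_cvg; [exact: sqrt_continuous | exact: cl].
suff <- : l = 0 by [].
apply/eqP; rewrite eq_le; apply/andP; split; last first.
  rewrite -(cvg_lim _ cl)//; apply: limr_ge; first by apply/cvg_ex; exists l.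
  by apply: nearW.
rewrite leNgt; apply/negP => l0.
have [n0 _ hn0] : \forall n \near \oo, l / 2 < u n.
  by apply: (cvgr_gt _ cl); lra.
pose H n := \sum_(0 <= m < n) h m.
(* From [n0] on [u] exceeds [l / 2], so a positive limit would bound the partial sums of
   [1 / (n + 2)]. *)
have hC n : (l / 2) * H n <= C + (l / 2) * H n0.
  have [nn0|n0n] := leqP n n0.
    have : H n <= H n0.
      by rewrite /H (big_cat_nat _ nn0)//= lerDl sumr_ge0// => i _; exact: ltW.
    have := uC 0%N; rewrite big_nil => C0 HH.
    by rewrite ler_wpDl// ler_wpM2l//; lra.
  rewrite /H (big_cat_nat _ (ltnW n0n))//= mulrDr addrC lerD2r mulr_sumr.
  apply: le_trans (uC n).
  rewrite [leRHS](big_cat_nat _ (ltnW n0n))//= -[leLHS]add0r.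
  apply: lerD; first by apply: sumr_ge0 => i _; rewrite mulr_ge0// ltW.
  rewrite big_nat [leRHS]big_nat; apply: ler_sum => i /andP[n0i _].
  by rewrite ler_pM2r//; apply: ltW; exact: hn0.
have [n] := inv_add2_sum_unbounded (C / (l / 2) + H n0).
rewrite -/(H n) => hn; have := hC n; rewrite leNgt => /negP; apply.
rewrite -(ltr_pM2l (_ : 0 < l / 2)) in hn; last lra.
by rewrite mulrDr (mulrC _ (C / _)) divfK// in hn; lra.
Qed.



Lemma squared_share_step (v w h : R) : 0 <= v <= 1 -> 0 <= w <= 1 ->
  `|v - w| <= h -> `|v ^+ 2 - w ^+ 2| <= 2 * h.
Proof.
move=> /andP[v0 v1] /andP[w0 w1]; rewrite subr_sqr normrM mulrC => vw.
by apply: ler_pM => //; rewrite ger0_norm; lra.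
Qed.

Lemma imbalance_share_step (b c b' c' h : R) :
  0 <= b <= 1 -> 0 <= c <= 1 -> 0 <= b' <= 1 -> 0 <= c' <= 1 ->
  `|b' - b| <= h -> `|c' - c| <= h ->
  `|(b' + c') * imbalance b' c' - (b + c) * imbalance b c| <= 64 * h.
Proof.
move=> b01 c01 b'01 c'01 hb hc.
have h0 : 0 <= h by apply: le_trans hb.
have bnd (v : R) : 0 <= v <= 1 -> (1 - 3 * v) ^+ 2 <= 4.
  by move=> /andP[v0 v1]; rewrite expr2; nra.
have stp (v w : R) : 0 <= v <= 1 -> 0 <= w <= 1 -> `|v - w| <= h ->
    `|(1 - 3 * v) ^+ 2 - (1 - 3 * w) ^+ 2| <= 12 * h.
  move=> /andP[v0 v1] /andP[w0 w1] vw.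
  have -> : (1 - 3 * v) ^+ 2 - (1 - 3 * w) ^+ 2 =
    (3 * (v + w) - 2) * 3 * (v - w) by ring.
  rewrite normrM; apply: ler_pM => //.
  by rewrite ler_norml; apply/andP; split; lra.
(* Product rule: each square is at most 4 and moves by at most [12 * h], whence
   [64 = 2 * 8 + 2 * (12 + 12)]. *)
have -> : (b' + c') * imbalance b' c' - (b + c) * imbalance b c =
  ((b' - b) + (c' - c)) * imbalance b' c' +
  (b + c) * (((1 - 3 * b') ^+ 2 - (1 - 3 * b) ^+ 2) +
             ((1 - 3 * c') ^+ 2 - (1 - 3 * c) ^+ 2)).
  by rewrite /imbalance; ring.
have -> : 64 * h = (h + h) * 8 + 2 * (12 * h + 12 * h) by ring.
apply: (le_trans (ler_normD _ _)); apply: lerD; rewrite normrM.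
  apply: ler_pM => //; first exact: le_trans (ler_normD _ _) (lerD hb hc).
  rewrite ger0_norm; last by apply: addr_ge0; exact: sqr_ge0.
  by rewrite /imbalance; have := bnd _ b'01; have := bnd _ c'01; lra.
apply: ler_pM => //.
  by case/andP: b01 => ? ?; case/andP: c01 => ? ?; rewrite ger0_norm; lra.
by apply: le_trans (ler_normD _ _) (lerD _ _); apply: stp.
Qed.

(** By [barbalat] the summed quantity [phi] tends to 0, which settles [x]. For [b] and [c], a
    barrier that [b + c] cannot cross downwards with small steps keeps it away from 0, so that
    [imbalance] itself tends to 0. *)
Lemma shares_cvg (x b c : nat -> R) (C delta : R) : 0 < delta ->
  (forall n, 0 <= x n <= 1) -> (forall n, 0 <= b n <= 1) ->
  (forall n, 0 <= c n <= 1) ->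
  (forall n, `|x n.+1 - x n| <= (n%:R + 2)^-1) ->
  (forall n, `|b n.+1 - b n| <= (n%:R + 2)^-1) ->
  (forall n, `|c n.+1 - c n| <= (n%:R + 2)^-1) ->
  (forall n, \sum_(0 <= m < n)
     (x m ^+ 2 + (b m + c m) * imbalance (b m) (c m)) * (m%:R + 2)^-1 <= C) ->
  (forall n0, exists2 n, (n0 <= n)%N & delta <= b n) ->
  [/\ x @ \oo --> 0, b @ \oo --> (3^-1 : R) & c @ \oo --> (3^-1 : R)].
Proof.
move=> d0 x01 b01 c01 dx db dc sC io.
pose s n := b n + c n; pose psi n := imbalance (b n) (c n).
pose phi n := x n ^+ 2 + s n * psi n.
have psi0 n : 0 <= psi n by apply: addr_ge0; exact: sqr_ge0.
have s0 n : 0 <= s n.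
  by rewrite /s; case/andP: (b01 n) => ? ?; case/andP: (c01 n) => ? ?; lra.
have w0 n : 0 <= s n * psi n by exact: mulr_ge0.
have phi0 n : 0 <= phi n by rewrite addr_ge0// sqr_ge0.
have cphi : phi @ \oo --> 0.
  apply: (@barbalat _ 66 C) => // n.
  have -> : 66 * (n%:R + 2)^-1 = 2 * (n%:R + 2)^-1 + 64 * (n%:R + 2)^-1 :> R.
    by ring.
  rewrite /phi opprD addrACA; apply: (le_trans (ler_normD _ _)); apply: lerD.
    exact: squared_share_step.
  exact: imbalance_share_step.
have sqr_small (u : nat -> R) (l k : R) : 0 < k ->
    (\forall n \near \oo, (u n - l) ^+ 2 <= k * phi n) -> u @ \oo --> l.
  move=> k0 hu; apply/cvgrPdist_lt => e e0.
  have e2 : 0 < e ^+ 2 / k by rewrite divr_gt0// exprn_gt0.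
  have hn0 : \forall n \near \oo, phi n < e ^+ 2 / k.
    exact: (cvgr_lt _ cphi).
  near=> n.
  have h1 : phi n < e ^+ 2 / k by near: n.
  rewrite ltr_pdivlMr// mulrC in h1.
  rewrite -ltr_sqr ?nnegrE ?normr_ge0 ?(ltW e0)//.
  rewrite real_normK ?num_real// -sqrrN opprB; apply: le_lt_trans h1.
  by near: n.
have cx : x @ \oo --> 0.
  apply: (sqr_small _ _ 1) => //; apply: nearW => n.
  by rewrite subr0 mul1r /phi; have := w0 n; lra.
(* The barrier is [eta / 2 < s < eta]: there [s < 1/3] forces [psi >= 1/2], hence
   [phi >= eta / 4]. *)
pose eta := Num.min delta (1 / 3).
have eta0 : 0 < eta by rewrite lt_min d0/=; lra.
have etad : eta <= delta by rewrite ge_min lexx.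
have eta3 : eta <= 1 / 3 by rewrite ge_min lexx orbT.
have [n1 _ hn1] : \forall n \near \oo,
    phi n < eta / 4 /\ 2 * (n%:R + 2)^-1 < eta / 2.
  have e4 : 0 < eta / 4 by lra.
  have hphi : \forall n \near \oo, phi n < eta / 4 by exact: (cvgr_lt _ cphi).
  have hharm : \forall n \near \oo, n.+1%:R^-1 < eta / 4.
    exact: (cvgr_lt _ (@cvg_harmonic R)).
  near=> n; split; first by near: n.
  suff : (n%:R + 2)^-1 < eta / 4 by lra.
  apply: (@le_lt_trans _ _ (n.+1%:R^-1)); last by near: n.
  have n0 := ler0n R n; rewrite lef_pV2 ?posrE -?[n.+1%:R]natr1; lra.
have [n2 n12 hn2] := io n1.
have hs n : (n2 <= n)%N -> eta <= s n.
  elim: n => [|n ih].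
    rewrite leqn0 => /eqP n20; move: hn2; rewrite n20 => ?.
    by rewrite /s; case/andP: (c01 0%N) => ? ?; lra.
  rewrite leq_eqVlt => /predU1P[<-|].
    by rewrite /s; case/andP: (c01 n2) => ? ?; lra.
  rewrite ltnS => n2n.
  (* In one step [s] loses at most [2 / (n + 2) < eta / 2], so it would have to land inside the
     barrier. *)
  have [_ hstep] := hn1 n (leq_trans n12 n2n).
  have [hphi _] := hn1 n.+1 (leq_trans n12 (leqW n2n)).
  have := dc n; have := db n; rewrite !ler_norml => /andP[db1 _] /andP[dc1 _].
  have sn1 : eta / 2 < s n.+1 by have := ih n2n; rewrite /s; lra.
  rewrite leNgt; apply/negP => sn2.
  have : eta / 4 <= phi n.+1.
    apply: (@le_trans _ _ (s n.+1 * psi n.+1)); last first.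
      by rewrite /phi; have := sqr_ge0 (x n.+1); lra.
    have -> : eta / 4 = eta / 2 * (1 / 2) by field.
    apply: ler_pM; [lra|lra|exact: ltW|].
    (* For a given sum, [imbalance] is least when both shares are equal. *)
    apply: (@le_trans _ _ (2 * (1 - 3 / 2 * s n.+1) ^+ 2)).
      by rewrite expr2; nra.
    rewrite -subr_ge0 (_ : _ - _ = 9 / 2 * (b n.+1 - c n.+1) ^+ 2).
      by rewrite mulr_ge0// ?sqr_ge0//; lra.
    by rewrite /psi /imbalance /s; field.
  lra.
have psi_small n : (n2 <= n)%N -> psi n <= eta^-1 * phi n.
  move=> n2n; rewrite mulrC ler_pdivlMr// /phi.
  have := ler_wpM2r (psi0 n) (hs n n2n); have := sqr_ge0 (x n); lra.
have third (u : nat -> R) :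
    (forall n, (1 - 3 * u n) ^+ 2 <= psi n) -> u @ \oo --> (3^-1 : R).
  move=> hu; apply: (sqr_small _ _ (eta^-1 / 9)).
    by rewrite divr_gt0 ?invr_gt0.
  exists n2 => // n /= /psi_small; have := hu n.
  have -> : (u n - 3^-1) ^+ 2 = (1 - 3 * u n) ^+ 2 / 9 by field.
  have -> : eta^-1 / 9 * phi n = eta^-1 * phi n / 9 by ring.
  lra.
split => //; apply: third => n; rewrite /psi /imbalance.
  by rewrite lerDl sqr_ge0.
by rewrite lerDr sqr_ge0.
Unshelve. all: by end_near.
Qed.

End Sequences.

(** * Bounded random variables *)

Section FiniteRange.
Variables (d : measure_display) (T : measurableType d).

(** The target [S] is discrete and carries no sigma-algebra, so measurability is asked of the
    fibres. *)
Definition simple_rv (S : choiceType) (X : T -> S) :=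
  (exists r : seq S, forall t, X t \in r) /\
  (forall x, measurable [set t | X t = x]).

Lemma measurable_simple_rv (S : choiceType) (X : T -> S) (Q : pred S) :
  simple_rv X -> measurable [set t | Q (X t)].
Proof.
move=> [[r rP] mX].
have -> : [set t | Q (X t)] = \big[setU/set0]_(x <- r | Q x) [set t | X t = x].
  apply/seteqP; split=> [t /= Qt|t].
    by rewrite -bigcup_seq_cond; exists (X t) => //=; rewrite rP.
  by rewrite -bigcup_seq_cond => -[x /= /andP[_ Qx] ->].
by apply: bigsetU_measurable => x _; exact: mX.
Qed.

Lemma simple_rv_comp (S S' : choiceType) (g : S -> S') (X : T -> S) :
  simple_rv X -> simple_rv (g \o X).
Proof.
move=> sX; split.
  by have [[r rP] _] := sX; exists (map g r) => t; exact: map_f.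
move=> y; have := measurable_simple_rv (fun x => g x == y) sX.
by congr measurable; apply/seteqP; split => t /= /eqP.
Qed.

Lemma simple_rv_pair (S S' : choiceType) (X : T -> S) (Y : T -> S') :
  simple_rv X -> simple_rv Y -> simple_rv (fun t => (X t, Y t)).
Proof.
move=> [[r rP] mX] [[r' rP'] mY]; split.
  by exists [seq (x, y) | x <- r, y <- r'] => t; exact: allpairs_f.
move=> [x y].
have -> : [set t | (X t, Y t) = (x, y)] = [set t | X t = x] `&` [set t | Y t = y].
  by apply/seteqP; split => [t [] //|t [/= -> ->]].
exact: measurableI.
Qed.

Lemma simple_rv_finType (S : finType) (X : T -> S) :
  (forall x, measurable [set t | X t = x]) -> simple_rv X.
Proof. by move=> mX; split => //; exists (enum S) => t; rewrite mem_enum. Qed.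

Lemma simple_rv_cst (S : choiceType) (x : S) : simple_rv (fun _ : T => x).
Proof.
split; first by exists [:: x] => t; rewrite mem_seq1.
move=> y; case: (x =P y) => xy.
  by rewrite [X in measurable X](_ : _ = setT)//; apply/seteqP; split.
by rewrite [X in measurable X](_ : _ = set0)//; apply/seteqP; split.
Qed.

End FiniteRange.

Section Expectation.
Variables (R : realType) (d : measure_display) (T : measurableType d).
Variable P : probability T R.
Implicit Types X Y : T -> R.

Definition bounded_rv X :=
  measurable_fun setT X /\ exists M, forall t, `|X t| <= M.

Lemma bounded_rv_integrable X : bounded_rv X -> P.-integrable setT (EFin \o X).
Proof.
move=> [mX [M XM]]; apply: measurable_bounded_integrable => //.
  by apply: le_lt_trans (ltry 1); exact: probability_le1.
exists M; split; first exact: num_real.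
by move=> x Mx t _ /=; apply: le_trans (XM t) (ltW Mx).
Qed.

Lemma bounded_rv_cst (k : R) : bounded_rv (fun=> k).
Proof. by split => //; exists `|k|. Qed.

Lemma bounded_rvD X Y : bounded_rv X -> bounded_rv Y ->
  bounded_rv (fun t => X t + Y t).
Proof.
move=> [mX [M XM]] [mY [M' YM]]; split; first exact: measurable_funD.
by exists (M + M') => t; apply: le_trans (ler_normD _ _) (lerD _ _).
Qed.

Lemma bounded_rvM X Y : bounded_rv X -> bounded_rv Y ->
  bounded_rv (fun t => X t * Y t).
Proof.
move=> [mX [M XM]] [mY [M' YM]]; split; first exact: measurable_funM.
by exists (M * M') => t; rewrite normrM; apply: ler_pM.
Qed.

Lemma bounded_rv_sum (I : Type) (r : seq I) (X : I -> T -> R) :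
  (forall i, bounded_rv (X i)) -> bounded_rv (fun t => \sum_(i <- r) X i t).
Proof.
move=> bX; elim: r => [|i r ih].
  under [X in bounded_rv X]funext do rewrite big_nil.
  exact: bounded_rv_cst.
under [X in bounded_rv X]funext do rewrite big_cons.
exact: bounded_rvD.
Qed.

Lemma bounded_rv_bool (b : T -> bool) :
  measurable [set t | b t] -> bounded_rv (fun t => (b t)%:R).
Proof.
move=> mb; split; last first.
  by exists 1 => t; case: (b t); rewrite /= ?normr1 ?normr0.
have -> : (fun t => (b t)%:R : R) = \1_[set t | b t].
  by apply/funext => t; rewrite indicE mem_setE.
exact: measurable_indic.
Qed.

Lemma Rintegral_bool (b : T -> bool) : measurable [set t | b t] ->
  \int[P]_t (b t)%:R = fine (P [set t | b t]).
Proof.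
move=> mb; rewrite /Rintegral; congr fine.
rewrite -[X in _ = P X]setIT -integral_indic//; apply: eq_integral => t _.
by rewrite indicE mem_setE.
Qed.

Lemma Rintegral_sum (I : Type) (r : seq I) (X : I -> T -> R) :
  (forall i, bounded_rv (X i)) ->
  \int[P]_t (\sum_(i <- r) X i t) = \sum_(i <- r) \int[P]_t X i t.
Proof.
move=> bX; elim: r => [|i r ih].
  rewrite big_nil; under eq_Rintegral do rewrite big_nil.
  by rewrite Rintegral_cst// mul0r.
rewrite big_cons -ih; under eq_Rintegral do rewrite big_cons.
apply: RintegralD => //; apply: bounded_rv_integrable => //.
exact: bounded_rv_sum.
Qed.

Lemma bounded_simple_rv (S : choiceType) (Z : T -> S) (f : S -> R) :
  simple_rv Z -> bounded_rv (fun t => f (Z t)).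
Proof.
move=> [[r rP] mZ].
have -> : (fun t => f (Z t)) =
    (fun t => \sum_(z <- undup r) (Z t == z)%:R * f z).
  apply/funext => t; rewrite (bigD1_seq (Z t)) ?undup_uniq ?mem_undup//=.
  rewrite eqxx mul1r big1 ?addr0// => z /negPf zZ.
  by rewrite eq_sym zZ mul0r.
apply: bounded_rv_sum => z; apply: bounded_rvM; last exact: bounded_rv_cst.
apply: bounded_rv_bool; have := mZ z; congr measurable.
by apply/seteqP; split => t /= /eqP.
Qed.

(** This plays the role of conditioning on [Z]: the range being finite, the inequalities over the
    events [Z = z] add up. *)
Lemma le_Rintegral_fibers (S : choiceType) (Z : T -> S) X Y : simple_rv Z ->
  bounded_rv X -> bounded_rv Y ->
  (forall z, \int[P]_t ((Z t == z)%:R * X t) <=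
             \int[P]_t ((Z t == z)%:R * Y t)) ->
  \int[P]_t X t <= \int[P]_t Y t.
Proof.
move=> sZ bX bY h; have [[r rP] mZ] := sZ.
have split_fibers U : bounded_rv U ->
    \int[P]_t U t = \sum_(z <- undup r) \int[P]_t ((Z t == z)%:R * U t).
  move=> bU; rewrite -Rintegral_sum; last first.
    move=> z; apply: bounded_rvM => //.
    exact: (bounded_simple_rv (fun z' => (z' == z)%:R)).
  apply: eq_Rintegral => t _.
  rewrite (bigD1_seq (Z t)) ?undup_uniq ?mem_undup//=.
  rewrite eqxx mul1r big1 ?addr0// => z /negPf zZ.
  by rewrite eq_sym zZ mul0r.
by rewrite !split_fibers//; exact: ler_sum.
Qed.

Lemma eq_Rintegral_fibers (S : choiceType) (Z : T -> S) X Y : simple_rv Z ->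
  bounded_rv X -> bounded_rv Y ->
  (forall z, \int[P]_t ((Z t == z)%:R * X t) =
             \int[P]_t ((Z t == z)%:R * Y t)) ->
  \int[P]_t X t = \int[P]_t Y t.
Proof.
move=> sZ bX bY h; apply/eqP; rewrite eq_le.
by apply/andP; split; apply: (le_Rintegral_fibers sZ) => // z; rewrite h.
Qed.

Lemma le_bounded_Rintegral X Y : bounded_rv X -> bounded_rv Y ->
  (forall t, X t <= Y t) -> \int[P]_t X t <= \int[P]_t Y t.
Proof.
by move=> bX bY XY; apply: le_Rintegral => //; exact: bounded_rv_integrable.
Qed.

Lemma bounded_RintegralD X Y : bounded_rv X -> bounded_rv Y ->
  \int[P]_t (X t + Y t) = \int[P]_t X t + \int[P]_t Y t.
Proof. by move=> bX bY; apply: RintegralD => //; exact: bounded_rv_integrable. Qed.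

Lemma bounded_RintegralZ X (k : R) : bounded_rv X ->
  \int[P]_t (k * X t) = k * \int[P]_t X t.
Proof. by move=> bX; apply: RintegralZl => //; exact: bounded_rv_integrable. Qed.

(* Fatou's lemma: [liminf Z n] is integrable, hence almost surely finite. *)
Lemma ae_bounded_infinitely_often (Z : nat -> T -> R) (C : R) :
  (forall n, bounded_rv (Z n)) -> (forall n t, 0 <= Z n t) ->
  (forall n, \int[P]_t Z n t <= C) ->
  {ae P, forall t, exists B, forall n0, exists2 n, (n0 <= n)%N & Z n t <= B}.
Proof.
move=> bZ Z0 ZC.
have mZ n : measurable_fun setT (fun t => (Z n t)%:E).
  by apply/measurable_EFinP; case: (bZ n).
pose F t := limn_einf (fun n => (Z n t)%:E).
have FE t : F t = ereal_sup (range (einfs (fun n => (Z n t)%:E))).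
  by rewrite /F limn_einf_lim; apply/cvg_lim => //; exact: cvg_einfs_sup.
have F0 t : (0 <= F t)%E.
  apply: (@le_trans _ _ (einfs (fun n => (Z n t)%:E) 0%N)).
    by apply: le_ereal_inf_tmp => _ [n _ <-]; rewrite lee_fin.
  by rewrite FE; apply: ereal_sup_ubound; exists 0%N.
have mF : measurable_fun setT F.
  apply: measurableT_comp => //; apply: measurable_fun_limn_esup => n.
  exact: measurableT_comp.
have FC : (\int[P]_t F t <= C%:E)%E.
  apply: le_trans (fatou P measurableT mZ _) _ => [n t _|].
    by rewrite lee_fin.
  rewrite limn_einf_lim; apply: lime_le; first exact: is_cvg_einfs.
  apply: nearW => n.
  apply: (@le_trans _ _ (\int[P]_t (Z n t)%:E)%E).
    by apply: ereal_inf_lbound; exists n => /=.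
  have := ZC n; rewrite -lee_fin /Rintegral fineK//.
  by apply: integrable_fin_num => //; exact: bounded_rv_integrable.
have iF : P.-integrable setT F.
  apply/integrableP; split => //.
  under eq_integral do rewrite gee0_abs//.
  exact: le_lt_trans FC (ltry _).
have := integrable_ae measurableT iF; apply: filterS => t /(_ I) Fin.
(* Every tail infimum is at most the lower limit, hence below this bound, so some later term is
   below it too. *)
exists (fine (F t) + 1) => n0.
have : (einfs (fun n => (Z n t)%:E) n0 < (fine (F t) + 1)%:E)%E.
  apply: (@le_lt_trans _ _ (F t)).
    by rewrite FE; apply: ereal_sup_ubound; exists n0.
  by rewrite -[ltLHS](fineK Fin) lte_fin ltrDl.
move=> /ereal_inf_lt[_ [n /= n0n <-]]; rewrite lte_fin => /ltW ZB.
by exists n.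
Qed.

End Expectation.

(** * The walk with fixed weights *)

Lemma geometric_squeeze (R : realType) (x C r : R) : 0 <= r < 1 ->
  (forall k, x <= C * r ^+ k) -> x <= 0.
Proof.
move=> /andP[r0 r1] h.
have c : (fun k => C * r ^+ k) @ \oo --> (C * 0 : R).
  by apply: cvgMr; apply: cvg_expr; rewrite ger0_norm.
rewrite -(mulr0 C) -(cvg_lim _ c)//; apply: limr_ge; last exact: nearW.
by apply/cvg_ex; exists (C * 0).
Qed.

Section Process.
Variables (G : ant_graph) (R : realType) (d : measure_display).
Variables (T : measurableType d) (P : probability T R).
Variable step : nat -> nat -> T -> edge G.
Hypothesis hstep : ant_process P step.

Lemma endpoint_rcons (p : seq (edge G)) e :
  endpoint (rcons p e) = across (endpoint p) e.
Proof. by rewrite /endpoint foldl_rcons. Qed.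

Lemma walk_sub n k k' t : (k <= k')%N ->
  {subset walk step n k t <= walk step n k' t}.
Proof.
elim: k' => [|k' ih]; first by rewrite leqn0 => /eqP ->.
rewrite leq_eqVlt => /predU1P[<-//|]; rewrite ltnS => /ih h e /h /=.
by case: ifP => // _; rewrite mem_rcons inE orbC => ->.
Qed.

Lemma walk_stopped n k k' t : endpoint (walk step n k t) = food G ->
  (k <= k')%N -> walk step n k' t = walk step n k t.
Proof.
move=> hF; elim: k' => [|k' ih]; first by rewrite leqn0 => /eqP ->.
rewrite leq_eqVlt => /predU1P[<-//|]; rewrite ltnS => /ih h /=.
by rewrite h hF eqxx.
Qed.

Lemma mem_trace_stopped n k t e : endpoint (walk step n k t) = food G ->
  (e \in trace step n t) = (e \in walk step n k t).
Proof.
move=> hF; rewrite inE; apply/asboolP/idP => [[k' he]|he]; last by exists k.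
have [k'k|kk'] := leqP k' k; first exact: walk_sub he.
by rewrite -(walk_stopped hF (ltnW kk')).
Qed.

(** As a finite function, the weight vector lives in a [choiceType] and can serve as the variable
    conditioned on. *)
Definition weights n t : {ffun edge G -> nat} := [ffun e => weight step n t e].

Lemma simple_walk n k : simple_rv (walk step n k).
Proof.
elim: k => [|k ih]; first exact: simple_rv_cst.
have ss : simple_rv (step n k).
  by apply: simple_rv_finType => e; exact: measurable_step hstep n k e.
exact: (simple_rv_comp (fun pe : seq (edge G) * edge G =>
  if endpoint pe.1 == food G then pe.1 else rcons pe.1 pe.2)
  (simple_rv_pair ih ss)).
Qed.

(** The trace depends on infinitely many steps, but [e] belongs to it on a countable union of events
    about finite walks, and there are finitely many edges. *)
Lemma simple_trace n : simple_rv (trace step n).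
Proof.
apply: simple_rv_finType => tau.
have mtr e : measurable [set t | e \in trace step n t].
  have -> : [set t | e \in trace step n t] =
      \bigcup_k [set t | e \in walk step n k t].
    apply/seteqP; split => t /=; rewrite inE; first by move/asboolP => [k ?]; exists k.
    by move=> [k _ ?]; apply/asboolP; exists k.
  apply: bigcupT_measurable => k.
  exact: (measurable_simple_rv (fun p : seq (edge G) => e \in p) (simple_walk n k)).
have -> : [set t | trace step n t = tau] =
    \bigcap_(e in setT) (if e \in tau then [set t | e \in trace step n t]
                         else ~` [set t | e \in trace step n t]).
  apply/seteqP; split => t /=.
    by move=> <- e _; case: ifPn => //= /negP.
  move=> h; apply/setP => e; have := h e I.
  by case: ifPn => //= _ /negP/negbTE.
apply: fin_bigcap_measurable; first exact: finite_finset.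
by move=> e _; case: ifP => _ //; exact: measurableC.
Qed.

Lemma simple_weights n : simple_rv (weights n).
Proof.
elim: n => [|n ih].
  have -> : weights 0 = fun=> [ffun=> 1%N].
    by apply/funext => t; apply/ffunP => e; rewrite !ffunE.
  exact: simple_rv_cst.
have -> : weights n.+1 =
  (fun wt : {ffun edge G -> nat} * {set edge G} =>
     [ffun e => (wt.1 e + (e \in wt.2))%N]) \o
  (fun t => (weights n t, trace step n t)).
  by apply/funext => t; apply/ffunP => e; rewrite !ffunE.
exact: simple_rv_comp (simple_rv_pair ih (simple_trace n)).
Qed.

Lemma bounded_step_data n k (f : _ -> _ -> _ -> _ -> R) :
  bounded_rv (fun t =>
    f (weights n t) (walk step n k t) (trace step n t) (step n k t)).
Proof.
have ss : simple_rv (step n k).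
  by apply: simple_rv_finType => e; exact: measurable_step hstep n k e.
exact: (bounded_simple_rv (fun z => f z.1.1.1 z.1.1.2 z.1.2 z.2)
  (simple_rv_pair (simple_rv_pair (simple_rv_pair (simple_weights n)
    (simple_walk n k)) (simple_trace n)) ss)).
Qed.

Lemma cross_prob_ge0 (w : edge G -> nat) (u : vertex G) e :
  0 <= cross_prob R w u e :> R.
Proof.
by rewrite /cross_prob; case: ifP => // _; rewrite divr_ge0// sumr_ge0.
Qed.

Lemma cross_prob_sum_le1 (w : edge G -> nat) (u : vertex G) :
  \sum_e cross_prob R w u e <= 1 :> R.
Proof.
rewrite /cross_prob -big_mkcond/= -mulr_suml.
have [->|s0] := eqVneq (\sum_(e' | incident u e') (w e')%:R : R) 0.
  by rewrite mul0r.
by rewrite divff.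
Qed.

(* The transition operator of the walk with weights [w], acting on functions of
   the sequence of edges crossed so far. *)
Definition walk_next (w : edge G -> nat) (f : seq (edge G) -> R)
    (p : seq (edge G)) : R :=
  if endpoint p == food G then f p
  else \sum_e cross_prob R w (endpoint p) e * f (rcons p e).

(** The Markov property of the walk. On each fibre of the first [k] steps it is [step_law], or
    trivial once the food is reached. *)
Lemma Rintegral_walkS n k (w : {ffun edge G -> nat}) (f : seq (edge G) -> R) :
  \int[P]_t ((weights n t == w)%:R * f (walk step n k.+1 t)) =
  \int[P]_t ((weights n t == w)%:R * walk_next w f (walk step n k t)).
Proof.
apply: (eq_Rintegral_fibers (simple_walk n k)).
- exact: (bounded_step_data n k.+1 (fun w' p _ _ => (w' == w)%:R * f p)).
- exact: (bounded_step_data n k (fun w' p _ _ => (w' == w)%:R * walk_next w f p)).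
move=> p; rewrite /walk_next /=.
have [pF|pF] := eqVneq (endpoint p) (food G).
  apply: eq_Rintegral => t _; case: eqP => [->|_]; last by rewrite !mul0r.
  by rewrite pF eqxx.
pose B t := (walk step n k t == p) && (weights n t == w).
have mB : measurable [set t | B t].
  apply: (@measurable_simple_rv _ _ _
    (fun t => (walk step n k t, weights n t)) (fun z => (z.1 == p) && (z.2 == w))).
  exact: simple_rv_pair (simple_walk n k) (simple_weights n).
have mBe e : measurable [set t | B t && (step n k t == e)].
  have -> : [set t | B t && (step n k t == e)] =
     [set t | B t] `&` [set t | step n k t = e].
    by apply/seteqP; split => t /=; [move=> /andP[? /eqP] | move=> [-> ->]; rewrite eqxx].
  by apply: measurableI => //; exact: measurable_step hstep n k e.
transitivity (\int[P]_t (\sum_e f (rcons p e) * (B t && (step n k t == e))%:R)).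
  apply: eq_Rintegral => t _; rewrite /B.
  case: eqP => [->|_] /=; last by rewrite mul0r big1// => e _; rewrite mulr0.
  rewrite (negPf pF) mul1r; case: eqP => [_|_] /=; last first.
    by rewrite mul0r big1// => e _; rewrite mulr0.
  rewrite mul1r (bigD1 (step n k t))//= eqxx mulr1 big1 ?addr0// => e /negPf.
  by rewrite eq_sym => ->; rewrite mulr0.
transitivity (\int[P]_t (\sum_e
    cross_prob R w (endpoint p) e * f (rcons p e) * (B t)%:R)); last first.
  apply: eq_Rintegral => t _; rewrite /B.
  case: eqP => [->|_] /=; last by rewrite mul0r big1// => e _; rewrite mulr0.
  by rewrite (negPf pF) mul1r -mulr_suml mulrC.
rewrite !Rintegral_sum; last 2 first.
- by move=> e; apply: bounded_rvM; [exact: bounded_rv_cst | exact: bounded_rv_bool].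
- by move=> e; apply: bounded_rvM; [exact: bounded_rv_cst | exact: bounded_rv_bool].
apply: eq_bigr => e _.
rewrite !bounded_RintegralZ; try exact: bounded_rv_bool.
rewrite !Rintegral_bool//.
(* The past event is the whole space: the weights are already fixed by [w]. *)
have := @step_law _ _ _ _ _ _ hstep n k setT w p e _ pF; cbv zeta.
have -> : setT `&` [set t | forall e', weight step n t e' = w e']
           `&` [set t | walk step n k t = p] = [set t | B t].
  apply/seteqP; split => t /=; rewrite /B.
    move=> [[_ hw] ->]; rewrite eqxx; apply/eqP/ffunP => e'.
    by rewrite ffunE hw.
  by move=> /andP[/eqP -> /eqP <-]; split=> //; split=> // e'; rewrite ffunE.
have -> : [set t | B t] `&` [set t | step n k t = e] = [set t | B t && (step n k t == e)].
  by apply/seteqP; split => t /=; [move=> [-> ->]; rewrite eqxx | move=> /andP[? /eqP]].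
move=> ->; last first.
  by rewrite -(setD0 setT); apply: sigma_algebraCD; exact: sigma_algebra0.
by rewrite fineM//= ?fin_num_measure// mulrCA mulrA.
Qed.

(** Iterates [Rintegral_walkS]: a supermartingale bound when [r = 1], a geometric decay when
    [r < 1]. *)
Lemma le_Rintegral_walk n (w : {ffun edge G -> nat}) (f : seq (edge G) -> R)
    (r : R) : 0 <= r -> (forall p, walk_next w f p <= r * f p) ->
  forall k, \int[P]_t ((weights n t == w)%:R * f (walk step n k t)) <=
    (f [::] * \int[P]_t (weights n t == w)%:R) * r ^+ k.
Proof.
move=> r0 hf; elim=> [|k ih].
  rewrite expr0 mulr1 -bounded_RintegralZ; last first.
    exact: (bounded_step_data n 0 (fun w' _ _ _ => (w' == w)%:R)).
  by under eq_Rintegral do rewrite mulrC.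
rewrite Rintegral_walkS exprSr mulrA.
apply: le_trans (ler_wpM2r r0 ih); rewrite mulrC -bounded_RintegralZ; last first.
  exact: (bounded_step_data n k (fun w' p _ _ => (w' == w)%:R * f p)).
apply: le_bounded_Rintegral.
- exact: (bounded_step_data n k (fun w' p _ _ => (w' == w)%:R * walk_next w f p)).
- exact: (bounded_step_data n k (fun w' p _ _ => r * ((w' == w)%:R * f p))).
by move=> t; case: eqP => _; rewrite ?mul0r ?mulr0// !mul1r.
Qed.

Lemma eq_Rintegral_walk n (w : {ffun edge G -> nat}) (f : seq (edge G) -> R) :
  (forall p, walk_next w f p = f p) ->
  forall k, \int[P]_t ((weights n t == w)%:R * f (walk step n k t)) =
    f [::] * \int[P]_t (weights n t == w)%:R.
Proof.
move=> hf; elim=> [|k <-].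
  rewrite -bounded_RintegralZ; last first.
    exact: (bounded_step_data n 0 (fun w' _ _ _ => (w' == w)%:R)).
  by under eq_Rintegral do rewrite mulrC.
by rewrite Rintegral_walkS; under eq_Rintegral do rewrite hf.
Qed.

(** Wherever the walk stands, it misses the food at the next step with probability at most [r]. On
    the cone graph some [r < 1] works because both other vertices are adjacent to the food. *)
Definition stays_below (w : edge G -> nat) (r : R) :=
  forall u, u != food G ->
    \sum_(e | across u e != food G) cross_prob R w u e <= r.

Lemma Rintegral_alive n (w : {ffun edge G -> nat}) (r : R) :
  0 <= r -> stays_below w r -> forall k,
  \int[P]_t ((weights n t == w)%:R *
             (endpoint (walk step n k t) != food G)%:R) <= r ^+ k.
Proof.
move=> r0 hr k.
apply: (le_trans (@le_Rintegral_walk n w (fun p => (endpoint p != food G)%:R) r r0 _ k)).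
  move=> p; rewrite /walk_next; case: ifPn => [->|pF]; first by rewrite mulr0.
  rewrite mulr1; apply: le_trans (hr _ pF); rewrite [leRHS]big_mkcond/=.
  apply: ler_sum => e _; rewrite endpoint_rcons.
  by case: ifP; rewrite ?mulr1 ?mulr0.
rewrite -[leRHS]mul1r ler_wpM2r ?exprn_ge0//= nest_neq_food mul1r.
rewrite Rintegral_bool; last first.
  exact: (measurable_simple_rv (fun w' => w' == w) (simple_weights n)).
by rewrite -lee_fin fineK ?fin_num_measure ?probability_le1//;
  exact: (measurable_simple_rv (fun w' => w' == w) (simple_weights n)).
Qed.

(* [u v] is the probability that a walk from [v] reaches the food without
   crossing [i]. *)
Lemma Rintegral_untraced n (w : {ffun edge G -> nat}) (r : R) (i : edge G)
    (u : vertex G -> R) :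
  0 <= r < 1 -> stays_below w r ->
  (forall v, 0 <= u v <= 1) -> u (food G) = 1 ->
  (forall v, v != food G ->
     \sum_(e | e != i) cross_prob R w v e * u (across v e) = u v) ->
  \int[P]_t ((weights n t == w)%:R * (i \notin trace step n t)%:R) =
  u (nest G) * \int[P]_t (weights n t == w)%:R.
Proof.
move=> r01 hr u01 uF hu; have /andP[r0 r1] := r01.
(* The probability, given the beginning [p], of ending without crossing [i]; the equations on [u]
   make it harmonic. *)
pose f p : R := (i \notin p)%:R * u (endpoint p).
have hf p : walk_next w f p = f p.
  rewrite /walk_next; case: ifPn => // pF; rewrite /f -(hu _ pF) mulr_sumr.
  rewrite [RHS]big_mkcond/=; apply: eq_bigr => e _.
  rewrite endpoint_rcons mem_rcons inE negb_or eq_sym.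
  by case: eqP => _ /=; rewrite ?mul0r ?mulr0// mulrCA.
have hE := eq_Rintegral_walk n hf.
have -> : u (nest G) = f [::] by rewrite /f mul1r.
set X := LHS.
pose alive k t : R :=
  (weights n t == w)%:R * (endpoint (walk step n k t) != food G)%:R.
have bX : bounded_rv (fun t => (weights n t == w)%:R * (i \notin trace step n t)%:R : R).
  exact: (bounded_step_data n 0 (fun w' _ tr _ => (w' == w)%:R * (i \notin tr)%:R)).
have bf k : bounded_rv (fun t => (weights n t == w)%:R * f (walk step n k t)).
  exact: (bounded_step_data n k (fun w' p _ _ => (w' == w)%:R * f p)).
have ba k : bounded_rv (alive k).
  exact: (bounded_step_data n k (fun w' p _ _ =>
    (w' == w)%:R * (endpoint p != food G)%:R)).
have halive := Rintegral_alive n r0 hr.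
have hf01 p : 0 <= f p <= 1.
  rewrite /f; have := u01 (endpoint p).
  by case: (i \notin p); rewrite ?mul1r// mul0r lexx ler01.
have stop k t : endpoint (walk step n k t) = food G ->
    f (walk step n k t) = (i \notin trace step n t)%:R.
  by move=> h; rewrite /f h uF mulr1 (mem_trace_stopped i h).
(* [f] of the first [k] steps differs from the indicator by at most 1, and only while the walk is
   alive, which has probability at most [r ^+ k]; so both inequalities follow as [k] grows. *)
apply/eqP; rewrite -subr_eq0 eq_le.
apply/andP; split; [|rewrite -oppr_le0 opprB];
  apply: (geometric_squeeze (C := 1) r01) => k; rewrite mul1r.
- rewrite lerBlDl -(hE k); apply: le_trans (lerD (lexx _) (halive k)).
  rewrite -bounded_RintegralD//; last exact: (ba k).
  apply: le_bounded_Rintegral => //; first by apply: bounded_rvD => //; exact: (ba k).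
  move=> t; case: eqP => _; rewrite ?mul0r ?addr0// !mul1r.
  have [/stop->|_] := eqVneq (endpoint (walk step n k t)) (food G).
    by rewrite addr0.
  have /andP[+ _] := hf01 (walk step n k t).
  by case: (i \notin _) => /=; lra.
- rewrite lerBlDl -(hE k); apply: le_trans (lerD (lexx _) (halive k)).
  rewrite -bounded_RintegralD//; last exact: (ba k).
  apply: le_bounded_Rintegral => //; first by apply: bounded_rvD => //; exact: (ba k).
  move=> t; case: eqP => _; rewrite ?mul0r ?addr0// !mul1r.
  have [/stop->|_] := eqVneq (endpoint (walk step n k t)) (food G).
    by rewrite addr0.
  have /andP[_] := hf01 (walk step n k t).
  by case: (i \notin _) => /=; lra.
Qed.

Lemma Rintegral_traced n (w : {ffun edge G -> nat}) (r : R) (i : edge G)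
    (u : vertex G -> R) :
  0 <= r < 1 -> stays_below w r ->
  (forall v, 0 <= u v <= 1) -> u (food G) = 1 ->
  (forall v, v != food G ->
     \sum_(e | e != i) cross_prob R w v e * u (across v e) = u v) ->
  \int[P]_t ((weights n t == w)%:R * (i \in trace step n t)%:R) =
  (1 - u (nest G)) * \int[P]_t (weights n t == w)%:R.
Proof.
move=> r01 hr u01 uF hu.
rewrite mulrBl mul1r -(Rintegral_untraced n r01 hr u01 uF hu).
apply/eqP; rewrite eq_sym subr_eq; apply/eqP; rewrite -bounded_RintegralD.
- by apply: eq_Rintegral => t _; rewrite -mulrDr; case: (i \in _);
    rewrite ?addr0 ?add0r mulr1.
- exact: (bounded_step_data n 0 (fun w' _ tr _ => (w' == w)%:R * (i \in tr)%:R)).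
- exact: (bounded_step_data n 0 (fun w' _ tr _ => (w' == w)%:R * (i \notin tr)%:R)).
Qed.

(** Only incident edges have positive probability, so the invariant [good] survives almost surely at
    every step; as the walk almost surely stops, it passes to the trace. *)
Lemma Rintegral_trace_pred n (w : {ffun edge G -> nat}) (r : R)
    (good : pred (seq (edge G))) (Q : pred {set edge G}) :
  0 <= r < 1 -> stays_below w r -> good [::] ->
  (forall p e, good p -> endpoint p != food G -> incident (endpoint p) e ->
     good (rcons p e)) ->
  (forall p, good p -> endpoint p = food G -> Q [set e in p]%SET) ->
  \int[P]_t ((weights n t == w)%:R * (~~ Q (trace step n t))%:R) = 0.
Proof.
move=> r01 hr g0 gS gQ; have /andP[r0 _] := r01.
have bad k : \int[P]_t ((weights n t == w)%:R * (~~ good (walk step n k t))%:R) <= 0.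
  apply: (le_trans (@le_Rintegral_walk n w (fun p => (~~ good p)%:R) 1 ler01 _ k)).
    move=> p; rewrite mul1r /walk_next; case: ifPn => // pF.
    case: (boolP (good p)) => [gp|_] /=; last first.
      apply: le_trans (cross_prob_sum_le1 w (endpoint p)).
      apply: ler_sum => e _; rewrite ler_piMr ?cross_prob_ge0//.
      by case: (good _); rewrite ?ler01 ?lexx.
    rewrite big1// => e _; rewrite /cross_prob; case: ifPn => [ie|_]; last by rewrite mul0r.
    by rewrite gS// mulr0.
  by rewrite g0 mul0r mul0r.
apply/eqP; rewrite eq_le; apply/andP; split; last first.
  by apply: Rintegral_ge0 => t _; rewrite mulr_ge0.
apply: (geometric_squeeze (C := 1) r01) => k; rewrite mul1r -[leRHS]add0r.
apply: le_trans (lerD (bad k) (Rintegral_alive n r0 hr k)).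
rewrite -bounded_RintegralD; last 2 first.
- exact: (bounded_step_data n k (fun w' p _ _ => (w' == w)%:R * (~~ good p)%:R)).
- exact: (bounded_step_data n k (fun w' p _ _ =>
    (w' == w)%:R * (endpoint p != food G)%:R)).
apply: le_bounded_Rintegral.
- exact: (bounded_step_data n k (fun w' _ tr _ => (w' == w)%:R * (~~ Q tr)%:R)).
- exact: (bounded_step_data n k (fun w' p _ _ => (w' == w)%:R * (~~ good p)%:R
     + (w' == w)%:R * (endpoint p != food G)%:R)).
move=> t; rewrite -mulrDr; apply: ler_wpM2l => //.
have [hF|_] := eqVneq (endpoint (walk step n k t)) (food G); last first.
  by case: (Q _) => /=; case: (good _) => /=; lra.
rewrite addr0; case: (boolP (good (walk step n k t))) => [gp|_].
  have -> : trace step n t = [set e in walk step n k t]%SET.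
    by apply/setP => e; rewrite (mem_trace_stopped e hF) inE.
  by rewrite gQ.
by case: (Q _); rewrite ?ler01.
Qed.

End Process.

(** * The cone graph *)

Definition edge1 : edge cone := @Ordinal 4 0 isT.
Definition edge2 : edge cone := @Ordinal 4 1 isT.
Definition edge3 : edge cone := @Ordinal 4 2 isT.
Definition edge4 : edge cone := @Ordinal 4 3 isT.

Lemma cone_edgeP (e : edge cone) :
  [\/ e = edge1, e = edge2, e = edge3 | e = edge4].
Proof.
by case: e => -[|[|[|[|//]]]] i; [apply: Or41|apply: Or42|apply: Or43|apply: Or44];
  apply: val_inj.
Qed.

Lemma cone_vertexP (v : vertex cone) : v != food cone -> v = coneN \/ v = coneP.
Proof.
by case: v => -[|[|[|//]]] i //= _; [left|right]; apply: val_inj.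
Qed.

Lemma cone_sum (V : nmodType) (Q : pred (edge cone)) (F : edge cone -> V) :
  \sum_(e | Q e) F e =
  (if Q edge1 then F edge1 else 0) + (if Q edge2 then F edge2 else 0) +
  (if Q edge3 then F edge3 else 0) + (if Q edge4 then F edge4 else 0).
Proof.
rewrite big_mkcond /= !big_ord_recl big_ord0 addr0 !addrA.
have e (i j : 'I_4) : val i = val j -> i = j by exact: val_inj.
have <- : ord0 = edge1 by apply: e.
have <- : lift ord0 ord0 = edge2 by apply: e.
have <- : lift ord0 (lift ord0 ord0) = edge3 by apply: e.
by have <- : lift ord0 (lift ord0 (lift ord0 ord0)) = edge4 by apply: e.
Qed.

Section ConeWalk.
Variable R : realType.
Variables (w : {ffun edge cone -> nat}) (a b c e : R).
Hypothesis w_gt0 : [/\ 0 < a, 0 < b, 0 < c & 0 < e].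
Hypothesis wE : [/\ a = (w edge1)%:R, b = (w edge2)%:R, c = (w edge3)%:R
  & e = (w edge4)%:R].

Lemma cross_prob_nest :
  [/\ cross_prob R w coneN edge1 = a / (a + b + c),
      cross_prob R w coneN edge2 = b / (a + b + c),
      cross_prob R w coneN edge3 = c / (a + b + c)
    & cross_prob R w coneN edge4 = 0].
Proof.
have [-> -> -> _] := wE.
by split; rewrite /cross_prob /= ?cone_sum /= ?addr0.
Qed.

Lemma cross_prob_P :
  [/\ cross_prob R w coneP edge1 = 0,
      cross_prob R w coneP edge2 = b / (b + c + e),
      cross_prob R w coneP edge3 = c / (b + c + e)
    & cross_prob R w coneP edge4 = e / (b + c + e)].
Proof.
have [_ -> -> ->] := wE.
by split; rewrite /cross_prob /= ?cone_sum /= ?add0r.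
Qed.

(** The larger of the probabilities, from [N] and from [P], of moving to the other of these two
    vertices. *)
Definition cone_stay : R :=
  Num.max ((b + c) / (a + b + c)) ((b + c) / (b + c + e)).

Lemma cone_stay01 : 0 <= cone_stay < 1.
Proof.
have [a0 b0 c0 e0] := w_gt0.
have /andP[h _] : 0 <= (b + c) / (a + b + c) <= 1 by apply: ratio_itv01; lra.
by rewrite le_max gt_max h !ratio_lt1//; lra.
Qed.

Lemma cone_stays_below : stays_below w cone_stay.
Proof.
have [a0 b0 c0 e0] := w_gt0.
have [n1 n2 n3 n4] := cross_prob_nest; have [p1 p2 p3 p4] := cross_prob_P.
move=> v /cone_vertexP[]->; rewrite cone_sum /=.
  by rewrite n2 n3 n4 add0r addr0 -mulrDl le_max lexx.
by rewrite p1 p2 p3 !add0r addr0 -mulrDl le_max lexx orbT.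
Qed.

Definition cone_fun (uN uP : R) (v : vertex cone) : R :=
  if v == coneN then uN else if v == coneP then uP else 1.

Lemma cone_fun01 uN uP : 0 <= uN <= 1 -> 0 <= uP <= 1 ->
  forall v, 0 <= cone_fun uN uP v <= 1.
Proof. by move=> ? ? v; rewrite /cone_fun; do 2?case: ifP => //; rewrite ler01 lexx. Qed.

Variables (d : measure_display) (T : measurableType d) (P : probability T R).
Variable step : nat -> nat -> T -> edge cone.
Hypothesis hstep : ant_process P step.

Lemma Rintegral_cross1 n :
  \int[P]_t ((weights step n t == w)%:R * (edge1 \in trace step n t)%:R) =
  direct_prob a b c e * \int[P]_t (weights step n t == w)%:R.
Proof.
have [a0 b0 c0 e0] := w_gt0.
have [n1 n2 n3 n4] := cross_prob_nest; have [p1 p2 p3 p4] := cross_prob_P.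
have ab0 : 0 < a * b by exact: mulr_gt0.
have ac0 : 0 < a * c by exact: mulr_gt0.
have ae0 : 0 < a * e by exact: mulr_gt0.
have eb0 : 0 < e * b by exact: mulr_gt0.
have ec0 : 0 < e * c by exact: mulr_gt0.
pose D := (a + e) * (b + c) + a * e.
have D0 : 0 < D by rewrite /D; lra.
(* The solution of [(a + b + c) uN = (b + c) uP] and [(b + c + e) uP = (b + c) uN + e]. *)
pose uN := e * (b + c) / D; pose uP := e * (a + b + c) / D.
rewrite (@Rintegral_traced _ _ _ _ _ _ hstep n _ cone_stay edge1 (cone_fun uN uP)).
- congr (_ * _); rewrite /cone_fun /= /uN /direct_prob -/D.
  by rewrite /D; field; rewrite -/D lt0r_neq0.
- exact: cone_stay01.
- exact: cone_stays_below.
- by apply: cone_fun01; apply: ratio_itv01; rewrite /D; lra.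
- by [].
move=> v /cone_vertexP[]->; rewrite cone_sum /cone_fun /=.
  rewrite n2 n3 n4 /uN /uP /D; field.
  by rewrite -/D !lt0r_neq0//; lra.
rewrite p2 p3 p4 /uN /uP /D; field.
by rewrite -/D !lt0r_neq0//; lra.
Qed.

Lemma Rintegral_cross2 n :
  \int[P]_t ((weights step n t == w)%:R * (edge2 \in trace step n t)%:R) =
  detour_prob a b c e * \int[P]_t (weights step n t == w)%:R.
Proof.
have [a0 b0 c0 e0] := w_gt0.
have [n1 n2 n3 n4] := cross_prob_nest; have [p1 p2 p3 p4] := cross_prob_P.
have ab0 : 0 < a * b by exact: mulr_gt0.
have ac0 : 0 < a * c by exact: mulr_gt0.
have ae0 : 0 < a * e by exact: mulr_gt0.
have eb0 : 0 < e * b by exact: mulr_gt0.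
have ec0 : 0 < e * c by exact: mulr_gt0.
have bc0 : 0 < b * c by exact: mulr_gt0.
have bb0 : 0 < b * b by exact: mulr_gt0.
pose D := (a + e) * (b + c) + a * e + b * (b + c + c).
have D0 : 0 < D by rewrite /D; lra.
(* Crossing edge 2 now counts as failure: [(a + b + c) uN = a + c uP] and
   [(b + c + e) uP = c uN + e], with determinant [D]. *)
pose uN := (a * (b + c + e) + c * e) / D.
pose uP := (a * c + e * (a + b + c)) / D.
rewrite (@Rintegral_traced _ _ _ _ _ _ hstep n _ cone_stay edge2 (cone_fun uN uP)).
- congr (_ * _); rewrite /cone_fun /= /uN /detour_prob -/D.
  by rewrite /D; field; rewrite -/D lt0r_neq0.
- exact: cone_stay01.
- exact: cone_stays_below.
- by apply: cone_fun01; apply: ratio_itv01; rewrite /D; lra.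
- by [].
move=> v /cone_vertexP[]->; rewrite cone_sum /cone_fun /=.
  rewrite n1 n3 n4 /uN /uP /D; field.
  by rewrite -/D !lt0r_neq0//; lra.
rewrite p1 p3 p4 /uN /uP /D; field.
by rewrite -/D !lt0r_neq0//; lra.
Qed.

Lemma Rintegral_cross3 n :
  \int[P]_t ((weights step n t == w)%:R * (edge3 \in trace step n t)%:R) =
  detour_prob a c b e * \int[P]_t (weights step n t == w)%:R.
Proof.
have [a0 b0 c0 e0] := w_gt0.
have [n1 n2 n3 n4] := cross_prob_nest; have [p1 p2 p3 p4] := cross_prob_P.
have ab0 : 0 < a * b by exact: mulr_gt0.
have ac0 : 0 < a * c by exact: mulr_gt0.
have ae0 : 0 < a * e by exact: mulr_gt0.
have eb0 : 0 < e * b by exact: mulr_gt0.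
have ec0 : 0 < e * c by exact: mulr_gt0.
have bc0 : 0 < b * c by exact: mulr_gt0.
have cc0 : 0 < c * c by exact: mulr_gt0.
pose D := (a + e) * (c + b) + a * e + c * (c + b + b).
have D0 : 0 < D by rewrite /D; lra.
pose uN := (a * (b + c + e) + b * e) / D.
pose uP := (a * b + e * (a + b + c)) / D.
rewrite (@Rintegral_traced _ _ _ _ _ _ hstep n _ cone_stay edge3 (cone_fun uN uP)).
- congr (_ * _); rewrite /cone_fun /= /uN /detour_prob -/D.
  by rewrite /D; field; rewrite -/D lt0r_neq0.
- exact: cone_stay01.
- exact: cone_stays_below.
- by apply: cone_fun01; apply: ratio_itv01; rewrite /D; lra.
- by [].
move=> v /cone_vertexP[]->; rewrite cone_sum /cone_fun /=.
  rewrite n1 n2 n4 /uN /uP /D; field.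
  by rewrite -/D !lt0r_neq0//; lra.
rewrite p1 p2 p4 /uN /uP /D; field.
by rewrite -/D !lt0r_neq0//; lra.
Qed.

End ConeWalk.

(** * Lyapunov function *)

Section Lyapunov.
Variable R : realType.

(** A discrete [log (m / k)], whose increments are exact rational expressions. *)
Definition harmonic_gap (k m : nat) : R := \sum_(k <= j < m) j%:R^-1.

Lemma harmonic_gap_ge0 k m : 0 <= harmonic_gap k m.
Proof. by apply: sumr_ge0 => j _; rewrite invr_ge0. Qed.

Lemma harmonic_gap_step (k m : nat) (b : bool) : (0 < k)%N -> (k <= m)%N ->
  harmonic_gap (k + b) m.+1 = harmonic_gap k m + m%:R^-1 - b%:R / k%:R.
Proof.
move=> k0 km; have gS : harmonic_gap k m.+1 = harmonic_gap k m + m%:R^-1.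
  by rewrite /harmonic_gap big_nat_recr.
case: b; last by rewrite addn0 mul0r subr0 gS.
by rewrite -gS addn1 div1r /harmonic_gap [in RHS]big_ltn ?ltnS// addrC addKr.
Qed.

(* [1 + 1 / j <= exp (1 / j)], and the left-hand sides telescope. *)
Lemma ratio_le_expR_gap (k m : nat) : (0 < k)%N -> (k <= m)%N ->
  m%:R <= k%:R * expR (harmonic_gap k m).
Proof.
move=> k0; elim: m => [|m ih]; first by rewrite leqn0 => /eqP k00; rewrite k00 in k0.
rewrite leq_eqVlt => /predU1P[<-|].
  by rewrite /harmonic_gap big_geq// expR0 mulr1.
rewrite ltnS => km; have m0 : 0 < m%:R :> R by rewrite ltr0n (leq_trans k0).
rewrite /harmonic_gap big_nat_recr//= expRD mulrA.
apply: (@le_trans _ _ (m%:R * expR m%:R^-1)).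
  rewrite -natr1 (_ : m%:R + 1 = m%:R * (1 + m%:R^-1)); last first.
    by field; rewrite lt0r_neq0.
  by rewrite ler_pM2l// expR_ge1Dx.
by rewrite ler_pM2r ?expR_gt0//; exact: ih.
Qed.

Implicit Types w : edge cone -> nat.

Definition share w (e : edge cone) (n : nat) : R := (w e)%:R / n.+2%:R.

Definition dissipation n w : R := share w edge4 n ^+ 2 +
  (share w edge2 n + share w edge3 n)
    * imbalance (share w edge2 n) (share w edge3 n).

(** The gaps produce the relative losses of the shares, and the terms [3 * share] turn the
    coefficients of those of edges 2 and 3 into [1 - 3 b] and [1 - 3 c], up to the error absorbed by
    [6 / n.+2%:R]. *)
Definition potential n w : R :=
  7 * harmonic_gap (w edge1) n.+2
  + harmonic_gap (w edge2) n.+2 + harmonic_gap (w edge3) n.+2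
  + 3 * share w edge2 n + 3 * share w edge3 n + 6 / n.+2%:R.

Lemma share_ge0 w e n : 0 <= share w e n.
Proof. by rewrite /share divr_ge0. Qed.

Lemma dissipation_ge0 n w : 0 <= dissipation n w.
Proof.
by rewrite addr_ge0 ?sqr_ge0// mulr_ge0 ?addr_ge0 ?share_ge0 ?sqr_ge0.
Qed.

Lemma dissipation_rate_ge0 n w : 0 <= dissipation n w / (324 * n.+2%:R).
Proof.
apply: divr_ge0; first exact: dissipation_ge0.
by apply: mulr_ge0; exact: ler0n.
Qed.

Lemma potential_ge0 n w : 0 <= potential n w.
Proof.
by rewrite /potential !addr_ge0 ?mulr_ge0 ?harmonic_gap_ge0 ?share_ge0 ?divr_ge0.
Qed.

(** The increment is affine in three crossing indicators, so its mean only requires their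
    probabilities. The constant [9 = 7 + 1 + 1] collects the new terms of the gaps. *)
Lemma potential_step n w (tau : {set edge cone}) :
  (forall e, 0 < w e <= n.+1)%N ->
  potential n.+1 (fun e => (w e + (e \in tau))%N) - potential n w =
  (9 / n.+2%:R
   - 3 * share w edge2 n / n.+3%:R - 3 * share w edge3 n / n.+3%:R
   + 6 / n.+3%:R - 6 / n.+2%:R)
  + ((- 7 / (w edge1)%:R) * (edge1 \in tau)%:R
  + (3 / n.+3%:R - (w edge2)%:R^-1) * (edge2 \in tau)%:R
  + (3 / n.+3%:R - (w edge3)%:R^-1) * (edge3 \in tau)%:R).
Proof.
move=> hw; rewrite /potential /share.
have gap e : harmonic_gap (w e + (e \in tau)) n.+3 =
    harmonic_gap (w e) n.+2 + n.+2%:R^-1 - (e \in tau)%:R / (w e)%:R.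
  by have /andP[? ?] := hw e; apply: harmonic_gap_step => //; exact: leqW.
rewrite !gap !natrD.
have w0 e : (w e)%:R != 0 :> R.
  by have /andP[w0 _] := hw e; rewrite pnatr_eq0 -lt0n.
have m2 : 0 < n.+2%:R :> R by rewrite ltr0n.
have -> : n.+3%:R = n.+2%:R + 1 :> R by rewrite natr1.
move: m2; set m : R := n.+2%:R; move=> m2.
have m1 : 0 < m + 1 by lra.
by field; rewrite !w0 !lt0r_neq0.
Qed.

End Lyapunov.

(** * Each walk uses one exit edge *)

Section Balance.
Variables (R : realType) (d : measure_display).
Variables (T : measurableType d) (P : probability T R).
Variable step : nat -> nat -> T -> edge cone.
Hypothesis hstep : ant_process P step.

Lemma weight_gt0 n t e : (0 < weight step n t e)%N.
Proof. by elim: n => //= n ih; rewrite ltn_addr. Qed.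

Lemma weight_le n t e : (weight step n t e <= n.+1)%N.
Proof. by elim: n => //= n ih; case: (_ \in _); rewrite ?addn1 ?addn0// leqW. Qed.

(** Comparing with the indicator of arrival makes this an invariant of unfinished walks as well. *)
Definition one_exit (p : seq (edge cone)) : bool :=
  ((edge1 \in p) + (edge4 \in p) == (endpoint p == food cone))%N.

Lemma one_exit_rcons p e : one_exit p -> endpoint p != food cone ->
  incident (endpoint p) e -> one_exit (rcons p e).
Proof.
rewrite /one_exit endpoint_rcons !mem_rcons !inE => + pF.
rewrite (negPf pF) addn_eq0 !eqb0 => /andP[/negPf -> /negPf ->].
by have [->|->] := cone_vertexP pF; have [->|->|->|->] := cone_edgeP e.
Qed.

Lemma Rintegral_one_exit n :
  \int[P]_t ((edge1 \in trace step n t) + (edge4 \in trace step n t) != 1)%N%:R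
  = 0 :> R.
Proof.
pose Q (tau : {set edge cone}) := ((edge1 \in tau) + (edge4 \in tau) == 1)%N.
have -> : 0 = \int[P]_t (0 : R) by rewrite Rintegral_cst// mul0r.
apply: (eq_Rintegral_fibers (simple_weights hstep n)).
- exact: (bounded_step_data hstep n 0 (fun _ _ tr _ => (~~ Q tr)%:R)).
- exact: bounded_rv_cst.
move=> w; under [RHS]eq_Rintegral do rewrite mulr0.
rewrite Rintegral_cst// mul0r.
(* Weights with a zero entry have an empty fibre; positive ones give [cone_stay < 1]. *)
have [w0|] := boolP [forall e, (0 < w e)%N]; last first.
  rewrite negb_forall => /existsP[e we].
  transitivity (\int[P]_t (0 : R)); last by rewrite Rintegral_cst// mul0r.
  apply: eq_Rintegral => t _; case: eqP => [wt|_]; last by rewrite mul0r.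
  by move: we; rewrite -wt ffunE weight_gt0.
have {}w0 e : 0 < (w e)%:R :> R by rewrite ltr0n; exact: (forallP w0).
have wpos := And4 (w0 edge1) (w0 edge2) (w0 edge3) (w0 edge4).
apply: (@Rintegral_trace_pred _ _ _ _ _ _ hstep n w _ one_exit Q
  (cone_stay01 wpos)).
- by apply: cone_stays_below; split.
- by [].
- exact: one_exit_rcons.
by move=> p gp pF; move: gp; rewrite /one_exit pF eqxx /Q !inE.
Qed.

Definition balanced n t :=
  (weight step n t edge1 + weight step n t edge4 == n.+2)%N.

Lemma Rintegral_balanced n : \int[P]_t (~~ balanced n t)%:R = 0 :> R.
Proof.
have bb m : bounded_rv (fun t => (~~ balanced m t)%:R : R).
  pose f (w : {ffun edge cone -> nat}) : R := (~~ (w edge1 + w edge4 == m.+2)%N)%:R.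
  have := bounded_step_data hstep m 0 (fun w _ _ _ => f w).
  by congr bounded_rv; apply/funext => t; rewrite /f !ffunE.
apply/eqP; rewrite eq_le; apply/andP; split; last first.
  exact: Rintegral_ge0.
elim: n => [|n ih].
  by rewrite /balanced /= Rintegral_cst// mul0r.
(* Union bound: imbalance at time [n.+1] requires imbalance at time [n] or a walk without exactly
   one exit. *)
rewrite -(addr0 0); apply: le_trans (lerD ih (lexx _)).
rewrite -(Rintegral_one_exit n) -bounded_RintegralD//; last first.
  exact: (bounded_step_data hstep n 0
    (fun _ _ tr _ => ((edge1 \in tr) + (edge4 \in tr) != 1)%N%:R)).
apply: le_bounded_Rintegral => //.
  apply: bounded_rvD => //.
  exact: (bounded_step_data hstep n 0
    (fun _ _ tr _ => ((edge1 \in tr) + (edge4 \in tr) != 1)%N%:R)).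
move=> t; rewrite -natrD ler_nat /balanced /= addnACA.
have [->|_] := eqVneq (weight step n t edge1 + weight step n t edge4)%N n.+2.
  by rewrite -[n.+3]addn1 eqn_add2l.
by rewrite (leq_trans (leq_b1 _)).
Qed.

End Balance.

(** * The Lyapunov supermartingale and its almost sure consequences *)

Section Supermartingale.
Variables (R : realType) (d : measure_display).
Variables (T : measurableType d) (P : probability T R).
Variable step : nat -> nat -> T -> edge cone.
Hypothesis hstep : ant_process P step.

Lemma weightsE n t : (weights step n t : edge cone -> nat) = weight step n t.
Proof. by apply/funext => e; rewrite ffunE. Qed.

Lemma weightsS n t : (weights step n.+1 t : edge cone -> nat) =
  (fun e => (weights step n t e + (e \in trace step n t))%N).
Proof. by apply/funext => e; rewrite !ffunE. Qed.

Definition increment n t : R :=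
  potential R n.+1 (weights step n.+1 t) - potential R n (weights step n t)
  + dissipation R n (weights step n t) / (324 * n.+2%:R).

Lemma bounded_increment n : bounded_rv (increment n).
Proof.
have -> : increment n = (fun t => potential R n.+1
    (fun e => (weights step n t e + (e \in trace step n t))%N)
    - potential R n (weights step n t)
    + dissipation R n (weights step n t) / (324 * n.+2%:R)).
  by apply/funext => t; rewrite /increment weightsS.
exact: (bounded_step_data hstep n 0 (fun w _ tr _ =>
  potential R n.+1 (fun e => (w e + (e \in tr))%N) - potential R n w
   + dissipation R n w / (324 * n.+2%:R))).
Qed.

Lemma Rintegral_increment_le0 n : \int[P]_t increment n t <= 0.
Proof.
have -> : 0 = \int[P]_t (0 : R) by rewrite Rintegral_cst// mul0r.
apply: (le_Rintegral_fibers (simple_weights hstep n)).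
- exact: bounded_increment.
- exact: bounded_rv_cst.
move=> w; under [leRHS]eq_Rintegral do rewrite mulr0.
rewrite Rintegral_cst// mul0r.
have [/forallP hw|] := boolP [forall e, 0 < w e <= n.+1]%N; last first.
  rewrite negb_forall => /existsP[e we].
  suff -> : \int[P]_t ((weights step n t == w)%:R * increment n t) = 0 by [].
  transitivity (\int[P]_t (0 : R)); last by rewrite Rintegral_cst// mul0r.
  apply: eq_Rintegral => t _; case: eqP => [wt|_]; last by rewrite mul0r.
  by move: we; rewrite -wt ffunE weight_gt0 weight_le.
have w0 e : 0 < (w e)%:R :> R by rewrite ltr0n; have /andP[] := hw e.
have wpos := And4 (w0 edge1) (w0 edge2) (w0 edge3) (w0 edge4).
pose I0 : T -> R := fun t => (weights step n t == w)%:R.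
pose I i : T -> R := fun t => (weights step n t == w)%:R * (i \in trace step n t)%:R.
have bI0 : bounded_rv I0.
  exact: (bounded_step_data hstep n 0 (fun w' _ _ _ => (w' == w)%:R)).
have bI i : bounded_rv (I i).
  exact: (bounded_step_data hstep n 0 (fun w' _ tr _ => (w' == w)%:R * (i \in tr)%:R)).
set p := \int[P]_t I0 t.
have h1 : \int[P]_t I edge1 t =
    direct_prob (w edge1)%:R (w edge2)%:R (w edge3)%:R (w edge4)%:R * p.
  by apply: (Rintegral_cross1 wpos _ hstep n); split.
have h2 : \int[P]_t I edge2 t =
    detour_prob (w edge1)%:R (w edge2)%:R (w edge3)%:R (w edge4)%:R * p.
  by apply: (Rintegral_cross2 wpos _ hstep n); split.
have h3 : \int[P]_t I edge3 t =
    detour_prob (w edge1)%:R (w edge3)%:R (w edge2)%:R (w edge4)%:R * p.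
  by apply: (Rintegral_cross3 wpos _ hstep n); split.
pose k0 : R := 9 / n.+2%:R
   - 3 * share R w edge2 n / n.+3%:R - 3 * share R w edge3 n / n.+3%:R
   + 6 / n.+3%:R - 6 / n.+2%:R + dissipation R n w / (324 * n.+2%:R).
pose k1 : R := - 7 / (w edge1)%:R.
pose k2 : R := 3 / n.+3%:R - (w edge2)%:R^-1.
pose k3 : R := 3 / n.+3%:R - (w edge3)%:R^-1.
have -> : \int[P]_t ((weights step n t == w)%:R * increment n t) =
  \int[P]_t (k0 * I0 t + (k1 * I edge1 t + (k2 * I edge2 t + k3 * I edge3 t))).
  apply: eq_Rintegral => t _; rewrite /I0 /I.
  case: eqP => [wt|_]; last by rewrite !mul0r !mulr0 !addr0.
  by rewrite /increment weightsS wt potential_step// !mul1r mulr1 /k0 /k1 /k2 /k3; ring.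
have bZ (k : R) X : bounded_rv X -> bounded_rv (fun t => k * X t).
  by move=> bX; apply: bounded_rvM => //; exact: bounded_rv_cst.
rewrite !bounded_RintegralD; do ?[exact: bZ | apply: bounded_rvD].
rewrite !bounded_RintegralZ// h1 h2 h3 -/p.
set q1 := direct_prob _ _ _ _; set q2 := detour_prob _ _ _ _.
set q3 := detour_prob _ _ _ _.
have -> : k0 * p + (k1 * (q1 * p) + (k2 * (q2 * p) + k3 * (q3 * p))) =
  (k0 + (k1 * q1 + (k2 * q2 + k3 * q3))) * p by ring.
have p0 : 0 <= p by apply: Rintegral_ge0 => t _; rewrite ler0n.
(* The total [n.+2] is only almost sure: a fibre with another value has mass [p = 0]. *)
have [ae|nae] := eqVneq (w edge1 + w edge4)%N n.+2; last first.
  suff -> : p = 0 by rewrite mulr0.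
  apply/eqP; rewrite eq_le p0 andbT -(Rintegral_balanced hstep n).
  apply: le_bounded_Rintegral => //.
    pose f (w' : {ffun edge cone -> nat}) : R := (~~ (w' edge1 + w' edge4 == n.+2)%N)%:R.
    have := bounded_step_data hstep n 0 (fun w' _ _ _ => f w').
    by congr bounded_rv; apply/funext => t; rewrite /f /balanced !ffunE.
  move=> t; rewrite /I0; case: eqP => // wt.
  by rewrite /balanced -!weightsE wt (negPf nae).
rewrite mulr_le0_ge0//.
have m2 : n.+2%:R = (w edge1)%:R + (w edge4)%:R :> R by rewrite -natrD ae.
have le2 e : (w e)%:R <= n.+2%:R :> R.
  by rewrite ler_nat leqW//; have /andP[] := hw e.
have := expected_increment_le0 (w0 edge1) (w0 edge2) (w0 edge3) (w0 edge4)
  (le2 edge2) (le2 edge3) m2 (erefl q2) (erefl q3).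
rewrite -/q1.
apply: le_trans; rewrite le_eqVlt; apply/orP; left; apply/eqP.
rewrite /k0 /k1 /k2 /k3 /dissipation /share.
have -> : n.+3%:R = n.+2%:R + 1 :> R by rewrite natr1.
have m20 : 0 < n.+2%:R :> R by rewrite ltr0n.
move: m20; set m : R := n.+2%:R; move=> m20.
have m10 : 0 < m + 1 by lra.
by field; rewrite !(lt0r_neq0 (w0 _)) !lt0r_neq0.
Qed.

Definition lyapunov n t : R := potential R n (weights step n t)
  + \sum_(0 <= m < n) dissipation R m (weights step m t) / (324 * m.+2%:R).

Lemma lyapunovS n t : lyapunov n.+1 t = lyapunov n t + increment n t.
Proof. by rewrite /lyapunov /increment big_nat_recr//=; ring. Qed.

Lemma bounded_lyapunov n : bounded_rv (lyapunov n).
Proof.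
apply: bounded_rvD.
  exact: (bounded_step_data hstep n 0 (fun w _ _ _ => potential R n w)).
apply: bounded_rv_sum => m.
exact: (bounded_step_data hstep m 0 (fun w _ _ _ =>
  dissipation R m w / (324 * m.+2%:R))).
Qed.

Lemma Rintegral_lyapunov_le n :
  \int[P]_t lyapunov n t <= \int[P]_t lyapunov 0 t.
Proof.
elim: n => // n ih; under eq_Rintegral do rewrite lyapunovS.
rewrite bounded_RintegralD; [|exact: bounded_lyapunov|exact: bounded_increment].
by rewrite -[leRHS]addr0 lerD// Rintegral_increment_le0.
Qed.

Lemma lyapunov_ge0 n t : 0 <= lyapunov n t.
Proof.
apply: addr_ge0; first exact: potential_ge0.
by apply: sumr_ge0 => m _; exact: dissipation_rate_ge0.
Qed.

Lemma ae_balanced : {ae P, forall t, forall n, balanced step n t}.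
Proof.
apply: ae_foralln => n.
have mb : measurable [set t | ~~ balanced step n t].
  have := measurable_simple_rv
    (fun w : {ffun edge cone -> nat} => w edge1 + w edge4 != n.+2)%N
    (simple_weights hstep n).
  by congr measurable; apply/seteqP; split=> t /=; rewrite /balanced !ffunE.
exists [set t | ~~ balanced step n t]; split => //.
  have := Rintegral_balanced hstep n; rewrite Rintegral_bool// => h0.
  by rewrite -[LHS]fineK ?fin_num_measure// h0.
by move=> t /= /negP.
Qed.

Lemma share_step n t e :
  `|share R (weight step n.+1 t) e n.+1 - share R (weight step n t) e n|
   <= (n%:R + 2)^-1.
Proof.
have -> : n%:R + 2 = n.+2%:R :> R by rewrite -natrD addn2.
have /= := weight_le step n t e; rewrite /share /= natrD.
set k := weight step n t e; set x : R := (e \in _)%:R => kn.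
have x01 : 0 <= x <= 1 by rewrite /x; case: (_ \in _); rewrite ?lexx ler01.
have k01 : (0 : R) <= k%:R <= (n.+2%:R : R).
  by apply/andP; split; [exact: ler0n | rewrite ler_nat leqW].
have -> : n.+3%:R = n.+2%:R + 1 :> R by rewrite natr1.
have m0 : 0 < n.+2%:R :> R by rewrite ltr0n.
move: m0 k01; set m : R := n.+2%:R; set y : R := k%:R => m0 /andP[y0 ym].
move/andP: x01 => [x0 x1].
have m1 : 0 < m + 1 by lra.
(* As [x] lies in [0, 1] and [y] in [0, [m]], the numerator [x * m - y] is at most [m] in absolute
   value. *)
have -> : (y + x) / (m + 1) - y / m = (x * m - y) / (m + 1) / m.
  by field; rewrite !lt0r_neq0.
rewrite normrM (gtr0_norm (x := m^-1)) ?invr_gt0// -[leRHS]mul1r ler_pM2r ?invr_gt0//.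
rewrite normrM (gtr0_norm (x := (m + 1)^-1)) ?invr_gt0// ler_pdivrMr// mul1r.
by rewrite ler_norml; apply/andP; split; nra.
Qed.

Lemma share_itv01 n t e : 0 <= share R (weight step n t) e n <= 1.
Proof.
apply: ratio_itv01; rewrite ?ler0n ?ltr0n// ler_nat.
exact: leqW (weight_le step n t e).
Qed.

Lemma shares_cvg_ae : {ae P, forall t,
  [/\ (share R (weight step n t) edge4 n) @[n --> \oo] --> (0 : R),
      (share R (weight step n t) edge2 n) @[n --> \oo] --> (3^-1 : R),
      (share R (weight step n t) edge3 n) @[n --> \oo] --> (3^-1 : R)
    & forall n, balanced step n t]}.
Proof.
have := ae_bounded_infinitely_often bounded_lyapunov lyapunov_ge0
  Rintegral_lyapunov_le.
apply: filterS2 ae_balanced => t bal [B io].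
suff [h1 h2 h3] : [/\ (share R (weight step n t) edge4 n) @[n --> \oo] --> (0 : R),
      (share R (weight step n t) edge2 n) @[n --> \oo] --> (3^-1 : R)
    & (share R (weight step n t) edge3 n) @[n --> \oo] --> (3^-1 : R)] by [].
(* [324 * B] undoes the factor 324 of [lyapunov]; [expR (- B)] bounds the share of edge 2 from below
   whenever its gap is at most [B]. *)
apply: (shares_cvg (C := 324 * B) (expR_gt0 (- B))).
- by move=> n; exact: share_itv01.
- by move=> n; exact: share_itv01.
- by move=> n; exact: share_itv01.
- by move=> n; exact: share_step.
- by move=> n; exact: share_step.
- by move=> n; exact: share_step.
- move=> n; have [n' nn' hn'] := io n.
  have -> : \sum_(0 <= m < n) (share R (weight step m t) edge4 m ^+ 2 +
      (share R (weight step m t) edge2 m + share R (weight step m t) edge3 m)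
      * imbalance (share R (weight step m t) edge2 m)
                  (share R (weight step m t) edge3 m)) * (m%:R + 2)^-1
     = 324 * \sum_(0 <= m < n) dissipation R m (weights step m t) / (324 * m.+2%:R).
    rewrite mulr_sumr; apply: eq_bigr => m _; rewrite /dissipation weightsE.
    have -> : m%:R + 2 = m.+2%:R :> R by rewrite -natrD addn2.
    by field; rewrite lt0r_neq0// ltr0n.
  (* By nonnegativity, the sum up to [n] is at most [lyapunov] at the later time [n'], where it is
     bounded by [B]. *)
  rewrite ler_pM2l ?ltr0n//; apply: le_trans hn'.
  rewrite /lyapunov (big_cat_nat _ nn')//= [leRHS]addrCA lerDl.
  apply: addr_ge0; first exact: potential_ge0.
  by apply: sumr_ge0 => m _; exact: dissipation_rate_ge0.
move=> n0; have [n nn hn] := io n0; exists n => //.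
have gapB : harmonic_gap R (weight step n t edge2) n.+2 <= B.
  apply: le_trans hn; rewrite /lyapunov /potential weightsE.
  have g i : 0 <= harmonic_gap R (weight step n t i) n.+2 by exact: harmonic_gap_ge0.
  have s i : 0 <= share R (weight step n t) i n by exact: share_ge0.
  have sm : 0 <= \sum_(0 <= m < n) dissipation R m (weights step m t) / (324 * m.+2%:R).
    by apply: sumr_ge0 => m _; exact: dissipation_rate_ge0.
  have n6 : 0 <= 6 / n.+2%:R :> R by rewrite divr_ge0.
  have := g edge1; have := g edge2; have := g edge3; have := s edge2; have := s edge3.
  move: n6 sm; set u := 6 / _; set v := \sum_(_ <= _ < _) _; lra.
rewrite /share ler_pdivlMr ?ltr0n// expRN mulrC ler_pdivrMr ?expR_gt0//.
apply: (le_trans (ratio_le_expR_gap R (weight_gt0 step n t edge2) _)).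
  exact: leqW (weight_le step n t edge2).
by rewrite ler_wpM2l// ler_expR.
Qed.

End Supermartingale.

(** * From shares to the normalised weight vector *)

Lemma row_cvg (R : realType) (n : nat) (f : nat -> 'rV[R]_n) (l : 'rV[R]_n) :
  (forall i, (f k 0 i) @[k --> \oo] --> l 0 i) -> f @ \oo --> l.
Proof.
move=> h; apply/cvg_ballP => eps eps0.
have : \forall k \near \oo, forall i, ball (l 0 i) eps (f k 0 i).
  by apply: filter_forall => i; move/cvg_ballP : (h i); exact.
by apply: filterS => k hk; split=> // i j; rewrite (ord1 i).
Qed.

Theorem proposition1p4 (R : realType) (d : measure_display)
    (T : measurableType d) (P : probability T R)
    (step : nat -> nat -> T -> edge cone) (hstep : ant_process P step) :
  {ae P, forall t,
    (n%:R^-1 *: weight_row R step n t) @[n --> \oo] --> cone_limit R}.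
Proof.
have := shares_cvg_ae hstep; apply: filterS => t [c4 c2 c3 bal].
have c1 : (share R (weight step n t) edge1 n) @[n --> \oo] --> (1 : R).
  have -> : (fun n => share R (weight step n t) edge1 n) =
     (fun n => 1 - share R (weight step n t) edge4 n).
    apply/funext => n.
    have nE : n.+2%:R = (weight step n t edge1)%:R + (weight step n t edge4)%:R :> R.
      by rewrite -natrD (eqP (bal n)).
    by rewrite /share nE; field; rewrite -nE pnatr_eq0.
  by rewrite -[X in _ --> X]subr0; apply: cvgB => //; exact: cvg_cst.
(* Shares are relative to [n + 2]; the factor [(n + 2) / n = 1 + 2 / n] passes to division by
   [n]. *)
have cn : (fun n => 1 + 2 * n%:R^-1 : R) @ \oo --> (1 : R).
  rewrite -[X in _ --> X]addr0 -[X in _ + X](mulr0 2).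
  apply: cvgD; first exact: cvg_cst.
  apply: cvgMr; rewrite -(cvg_shiftS (fun n => n%:R^-1 : R)).
  exact: cvg_harmonic.
apply: row_cvg => i.
suff : (share R (weight step n t) i n * (1 + 2 * n%:R^-1)) @[n --> \oo] -->
    cone_limit R 0 i.
  (* Time 0 is left out: there [n%:R^-1] is 0 and the two sequences differ. *)
  apply: cvg_trans; apply: near_eq_cvg; exists 1%N => // n /= n0.
  rewrite !mxE /share.
  have n0' : 0 < n%:R :> R by rewrite ltr0n.
  have -> : n.+2%:R = n%:R + 2 :> R by rewrite -natrD addn2.
  by field; rewrite !lt0r_neq0//; lra.
rewrite -[cone_limit R 0 i]mulr1; apply: cvgM => //; rewrite mxE.
by have [->|->|->|->] := cone_edgeP i.
Qed.
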